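(* If $G$ is a $2$-edge-connected graph, then $\bar{\lambda}_{\max}(G)/\bar{\lambda}(G)\ge 1/3$.
   Context: Graphs are finite and simple. For a graph $G$ of order $n$ and distinct vertices $u,v$, $\lambda_G(u,v)$ is the maximum number of edge-disjoint $u$--$v$ paths, and $\bar{\lambda}(G)=\binom{n}{2}^{-1}\sum_{\{u,v\}}\lambda_G(u,v)$ over unordered pairs of distinct vertices. An orientation of $G$ is obtained by directing each edge. For a digraph $D$, $\lambda_D(u,v)$ is the maximum number of arc-disjoint directed $u$--$v$ paths and $\bar{\lambda}(D)=\frac{1}{n(n-1)}\sum_{(u,v)}\lambda_D(u,v)$ over ordered pairs of distinct vertices; $\bar{\lambda}_{\max}(G)$ is the maximum of $\bar{\lambda}(D)$ over all orientations $D$ of $G$. *)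

(* Defs.v *)
From HB Require Import structures.
From mathcomp Require Import all_boot all_order all_algebra.

Set Implicit Arguments.
Unset Strict Implicit.
Unset Printing Implicit Defensive.

Import Order.TTheory GRing.Theory Num.Theory.

Section Definitions.

Variable T : finType.

Section Paths.

(* An adjacency relation: symmetric and irreflexive for a simple graph,
   arbitrary for a digraph. *)
Variable r : rel T.

(* The path visits u :: p; being duplicate-free, p has at most #|T| vertices,
   so that #|T|.-bseq T contains all paths and is a finite type. *)
Definition is_path (u v : T) (p : #|T|.-bseq T) : bool :=
  [&& path r u p, last u p == v & uniq (u :: p)].

End Paths.

Definition path_arcs (u : T) (p : seq T) : seq (T * T) :=
  zip (belast u p) p.

Definition path_edges (u : T) (p : seq T) : seq {set T} :=
  [seq [set a.1; a.2] | a <- path_arcs u p].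

(* Families are sets rather than sequences of paths: for u != v every u-v path
   has an edge, so no path can occur twice in an edge-disjoint family. *)
Definition edge_disjoint_paths (e : rel T) (u v : T)
    (P : {set #|T|.-bseq T}) : bool :=
  [forall p in P, is_path e u v p] &&
  [forall p in P, forall q in P,
     (p != q) ==> [disjoint path_edges u p & path_edges u q]].

Definition arc_disjoint_paths (d : rel T) (u v : T)
    (P : {set #|T|.-bseq T}) : bool :=
  [forall p in P, is_path d u v p] &&
  [forall p in P, forall q in P,
     (p != q) ==> [disjoint path_arcs u p & path_arcs u q]].

Definition lambda_graph (e : rel T) (u v : T) : nat :=
  \max_(P | edge_disjoint_paths e u v P) #|P|.

Definition lambda_digraph (d : rel T) (u v : T) : nat :=
  \max_(P | arc_disjoint_paths d u v P) #|P|.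

(* Each unordered pair {u, v} is counted once, through the ordering of its
   two elements by their position in the enumeration of T. *)
Definition avg_lambda_graph (e : rel T) : rat :=
  (('C(#|T|, 2)%:R)^-1 *
   \sum_(u : T) \sum_(v : T | (enum_rank u < enum_rank v)%N)
      (lambda_graph e u v)%:R)%R.

Definition avg_lambda_digraph (d : rel T) : rat :=
  (((#|T| * #|T|.-1)%:R)^-1 *
   \sum_(u : T) \sum_(v : T | u != v) (lambda_digraph d u v)%:R)%R.

Definition arc_rel (D : {set T * T}) : rel T := [rel x y | (x, y) \in D].

Definition is_orientation (e : rel T) (D : {set T * T}) : bool :=
  [forall x, forall y,
     if e x y then arc_rel D x y (+) arc_rel D y x else ~~ arc_rel D x y].

(* The default value 0 is harmless: every graph has an orientation, and the
   averages are nonnegative. *)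
Definition max_avg_lambda (e : rel T) : rat :=
  \big[Num.max/0%R]_(D | is_orientation e D) avg_lambda_digraph (arc_rel D).

Definition edge_set (e : rel T) : {set {set T}} :=
  [set [set a.1; a.2] | a in [pred a : T * T | e a.1 a.2]].

Definition delete_edges (e : rel T) (F : {set {set T}}) : rel T :=
  [rel x y | e x y && ([set x; y] \notin F)].

Definition connected_graph (e : rel T) : Prop := forall x y, connect e x y.

Definition edge_connected (k : nat) (e : rel T) : Prop :=
  1 < #|T| /\
  forall F : {set {set T}}, F \subset edge_set e -> #|F| < k ->
    connected_graph (delete_edges e F).

End Definitions.

(* Main.v *)
Require Import Defs.
From Stdlib Require Import Classical.
From mathcomp Require Import all_boot all_order all_algebra.
From mathcomp Require Import zify ring.

Set Implicit Arguments.
Unset Strict Implicit.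
Unset Printing Implicit Defensive.

(** By Nash-Williams, every graph has an orientation in which
    [lambda_D(u, v) >= floor (lambda_G(u, v) / 2)] for all [u], [v]; in a
    2-edge-connected graph [lambda_G(u, v) >= 2], and [floor (m / 2) >= m / 3]
    for [m >= 2].

    The orientation comes from a multigraph [M] on the odd vertices with
    [d_M(X) <= d_G(X) - R(X)], where [R(X)] is the largest even number
    [2 floor (lambda_G(x, y) / 2)] with [x] in [X] and [y] outside: [G + M] is
    Eulerian, and an Eulerian orientation of it has at least [R(X) / 2] arcs of
    [G] leaving [X], so that Menger's theorem applies.

    [M] exists by induction on the number of edges.  In a minimal
    counterexample every edge lies in a tight cut ([d(X) = R(X)]; otherwise it
    is deleted and put into [M]), and every tight cut isolates a single vertex
    (otherwise both sides are contracted and, [R] being skew supermodular, the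
    two pairings are put together).  Let [s] be a tight vertex of minimum
    degree [D].  The vertices with [R(x) < D] form an independent set on which
    the requirement holds automatically, and contracting both sides of cuts of
    size [R(X) + 1] shows that the other vertices have requirement at least [D]
    pairwise.  So it suffices to split off two edges at [s] while preserving
    the requirement between these other vertices, and Frank's uncrossing
    argument for Mader's splitting theorem provides such a pair of edges. *)

(** * Cuts of multigraphs given as sequences of pairs *)

Section Cuts.
Variable T : finType.
Implicit Types (E M : seq (T * T)) (X Y A B C : {set T}) (x y z : T).

Definition crosses X (e : T * T) : bool := (e.1 \in X) (+) (e.2 \in X).
Definition cut E X : nat := count (crosses X) E.
(** An edge inside [A :&: B] counts twice; this keeps [en] symmetric and additive in each argument
    even when [A] and [B] meet. *)
Definition en E A B : nat :=
  count (fun e => (e.1 \in A) && (e.2 \in B)) E +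
  count (fun e => (e.1 \in B) && (e.2 \in A)) E.
(** The measure of the main induction: a loop crosses no set, and contraction, shortcutting and
    splitting off may all turn edges into loops. *)
Definition nonloops E : nat := count (fun e => e.1 != e.2) E.

Arguments cut : simpl never.
Arguments en : simpl never.
Arguments nonloops : simpl never.

Ltac by_edge :=
  rewrite ?/cut ?/en ?/crosses;
  match goal with |- context [count _ ?E] =>
    elim: E => //= [[? ?] ?] /=; rewrite ?inE end;
  repeat match goal with
    | |- context [?x \in ?X] => case: (x \in X) => /=
  end; lia.

Lemma cut_cat E M X : cut (E ++ M) X = cut E X + cut M X.
Proof. exact: count_cat. Qed.

Lemma cut0 E : cut E set0 = 0.
Proof. by_edge. Qed.

Lemma cutC E X : cut E (~: X) = cut E X.
Proof. by_edge. Qed.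

Lemma cut_submod E X Y :
  cut E X + cut E Y =
  cut E (X :&: Y) + cut E (X :|: Y) + (en E (X :\: Y) (Y :\: X)).*2.
Proof. by_edge. Qed.

Lemma cut_posimod E X Y :
  cut E X + cut E Y =
  cut E (X :\: Y) + cut E (Y :\: X) + (en E (X :&: Y) (~: (X :|: Y))).*2.
Proof. by_edge. Qed.

Lemma cut_en E X : cut E X = en E X (~: X).
Proof. by_edge. Qed.

Lemma enC E A B : en E A B = en E B A.
Proof. by rewrite /en addnC. Qed.

Lemma en0 E A : en E A set0 = 0.
Proof. by_edge. Qed.

Lemma en_split E A B C : en E A B = en E A (B :&: C) + en E A (B :\: C).
Proof. by_edge. Qed.

Lemma enU E A B C : [disjoint B & C] -> en E A (B :|: C) = en E A B + en E A C.
Proof.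
move=> dBC; rewrite (en_split E A (B :|: C) B) setIUl setIid.
rewrite [C :&: B]setIC (disjoint_setI0 dBC) setU0 setDUl setDv set0U.
by rewrite (setDidPl _) // disjoint_sym.
Qed.

Lemma enS E A B C : B \subset C -> en E A B <= en E A C.
Proof. by move=> sBC; rewrite (en_split E A C B) (setIidPr sBC) leq_addr. Qed.

Lemma en2S E A A' B B' : A \subset A' -> B \subset B' -> en E A B <= en E A' B'.
Proof.
by move=> sA sB; apply: leq_trans (enS _ _ sB) _; rewrite enC [leqRHS]enC enS.
Qed.

Lemma en_le_cut E A B : [disjoint A & B] -> en E A B <= cut E A.
Proof. by move=> dAB; rewrite cut_en enS // -disjoints_subset disjoint_sym. Qed.

Lemma cutU E A B : [disjoint A & B] ->
  cut E (A :|: B) + (en E A B).*2 = cut E A + cut E B.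
Proof.
move=> dAB; rewrite cut_submod (disjoint_setI0 dAB) cut0 add0n.
by rewrite !(setDidPl _) // disjoint_sym.
Qed.

Lemma cutU_le E A B : cut E (A :|: B) <= cut E A + cut E B.
Proof. by rewrite cut_submod; lia. Qed.

Lemma odd_cutU E A B : [disjoint A & B] ->
  odd (cut E (A :|: B)) = odd (cut E A) (+) odd (cut E B).
Proof. by move=> /(cutU E) h; rewrite -oddD -h oddD odd_double addbF. Qed.

Lemma cut_cons e E X : cut (e :: E) X = crosses X e + cut E X.
Proof. by []. Qed.

Lemma cut_perm E M X : perm_eq E M -> cut E X = cut M X.
Proof. by move/permP; apply. Qed.

Lemma en_perm E M A B : perm_eq E M -> en E A B = en M A B.
Proof. by move/permP => h; rewrite /en !h. Qed.

(** * Shortcutting *)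

Lemma edge_out E A B : [disjoint A & B] -> 0 < en E A B ->
  exists x y E', [/\ x \in A, y \in B & (perm_eq E ((x, y) :: E') \/ perm_eq E ((y, x) :: E'))].
Proof.
move=> dAB; rewrite /en addn_gt0 -!has_count => /orP[] /hasP[[x y] Exy /= /andP[hx hy]].
  by exists x, y, (rem (x, y) E); split=> //; left; apply: perm_to_rem.
by exists y, x, (rem (x, y) E); split=> //; right; apply: perm_to_rem.
Qed.

(** Deleting an edge is recorded through its effect on the three counts, none of which depends on
    the order of the pair. *)
Lemma edge_at E A B : [disjoint A & B] -> 0 < en E A B ->
  exists x y E', [/\ x \in A, y \in B, forall X, cut E X = crosses X (x, y) + cut E' X,
    forall X Y, en E X Y = en [:: (x, y)] X Y + en E' X Y & nonloops E = (nonloops E').+1].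
Proof.
move=> dAB /(edge_out dAB)[x [y [E' [hx hy hE]]]].
have nxy : x != y by apply: contraTneq hx => ->; rewrite (disjointFl dAB hy).
exists x, y, E'; split=> // [X|X Y|].
- by case: hE => hE; rewrite (cut_perm _ hE) cut_cons // /crosses /= addbC.
- case: hE => hE; rewrite (en_perm _ _ hE) /en /=; last lia.
  lia.
- by rewrite /nonloops; case: hE => /permP -> /=; rewrite ?nxy // eq_sym nxy.
Qed.

Lemma cut1_en E x : cut E [set x] = en E [set x] [set~ x].
Proof. exact: cut_en. Qed.

Lemma disj1C x : [disjoint [set x] & [set~ x]].
Proof. by rewrite disjoints_subset setCK. Qed.

(* Two edges xa, xb of M at the same vertex are replaced by ab. *)
Lemma shortcut M : exists M',
  [/\ forall X, odd (cut M' X) = odd (cut M X), forall X, cut M' X <= cut M X &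
      forall x, cut M' [set x] <= 1].
Proof.
have [n] := ubnP (nonloops M); elim: n M => // n IH M; rewrite ltnS => le_n.
have [/forallP h|] := boolP [forall x, cut M [set x] <= 1]; first by exists M.
rewrite negb_forall => /existsP[x]; rewrite -ltnNge => lt1.
have /(edge_at (disj1C x))[x' [a [M1 [/set1P -> ha cM eM nM]]]] :
  0 < en M [set x] [set~ x] by rewrite -cut1_en; lia.
have c1 : 0 < cut M1 [set x].
  by move: lt1; rewrite cM /crosses /= !inE eqxx; case: (a == x) => /=; lia.
have /(edge_at (disj1C x))[x'' [b [M2 [/set1P -> hb cM1 _ nM1]]]] :
  0 < en M1 [set x] [set~ x] by rewrite -cut1_en.
have lt_n : nonloops ((a, b) :: M2) < n by rewrite /nonloops /= -/(nonloops M2); lia.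
have [M' [odd' le' deg']] := IH _ lt_n.
exists M'; split=> // X.
  rewrite odd' cut_cons cM cM1 /crosses /=.
  by case: (x \in X); case: (a \in X); case: (b \in X) => /=; rewrite ?oddD ?odd_double /= ?negbK.
apply: leq_trans (le' X) _; rewrite cut_cons cM cM1 /crosses /=.
by case: (x \in X); case: (a \in X); case: (b \in X) => /=; lia.
Qed.

(** * Eulerian orientations *)

Definition orients (O F : seq (T * T)) : bool :=
  perm_eq [seq [set a.1; a.2] | a <- O] [seq [set a.1; a.2] | a <- F].

(** Induction on the number of edges. By parity an edge [xa] has a companion [xb] at [x]; an
    orientation of the graph with [ab] in place of the two is lifted by routing that arc through
    [x]. *)
Lemma eulerian_orientation F : (forall x, ~~ odd (cut F [set x])) ->
  exists O, orients O F /\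
    forall x, count (fun a => a.1 == x) O = count (fun a => a.2 == x) O.
Proof.
have [n] := ubnP (size F); elim: n F => // n IH [|[x a] F] /=.
  by move=> _ _; exists [::].
rewrite ltnS => le_n evenF.
have [eq_xa|nxa] := eqVneq x a.
  subst a; have {}evenF y : ~~ odd (cut F [set y]).
    by have := evenF y; rewrite cut_cons /crosses addbb.
  have [O [hO bO]] := IH _ le_n evenF.
  exists ((x, x) :: O); split; last by move=> y /=; rewrite bO.
  by rewrite /orients /= perm_cons.
have : odd (cut F [set x]).
  by have := evenF x; rewrite cut_cons /crosses /= !inE eqxx eq_sym (negbTE nxa) /= negbK.
move/odd_gt0; rewrite cut1_en => /(edge_out (disj1C x))[x' [b [F2 [/set1P -> hb hF]]]].
have [f [hf hF2]] : exists f, (f = (x, b) \/ f = (b, x)) /\ perm_eq F (f :: F2).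
  by case: hF => hF; [exists (x, b) | exists (b, x)]; split; auto.
have szF : size F = (size F2).+1 by rewrite (perm_size hF2).
have cF X : cut F X = crosses X (x, b) + cut F2 X.
  by rewrite (cut_perm _ hF2) cut_cons; case: hf => ->; rewrite // /crosses /= addbC.
have lt_n : size ((a, b) :: F2) < n by rewrite /= -szF.
have even2 y : ~~ odd (cut ((a, b) :: F2) [set y]).
  have := evenF y; rewrite !cut_cons cF /crosses /=.
  by case: (x \in _); case: (a \in _); case: (b \in _) => /=; rewrite ?oddD ?odd_double ?negbK.
have [O [hO bO]] := IH _ lt_n even2.
(* Any arc with ends [a] and [b] can play the new edge, since [orients] does not tell parallel edges
   apart. *)
have : [set a; b] \in [seq [set c.1; c.2] | c <- O].
  by rewrite (perm_mem hO) /= mem_head.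
case/mapP => -[c1 c2] Oc /= eq_ab.
have pO := perm_to_rem Oc; set O' := rem _ _ in pO.
have set_f : [set f.1; f.2] = [set x; b] by case: hf => -> //=; rewrite setUC.
have hO' : perm_eq [seq [set c.1; c.2] | c <- O'] [seq [set c.1; c.2] | c <- F2].
  rewrite -(perm_cons [set a; b]).
  apply: perm_trans hO; rewrite perm_sym {1}eq_ab.
  exact: (perm_map (fun c : T * T => [set c.1; c.2]) pO).
have c_ab : (c1, c2) = (a, b) \/ (c1, c2) = (b, a).
  have := set21 c1 c2; have := set22 c1 c2; rewrite -eq_ab !inE.
  have := set21 a b; have := set22 a b; rewrite eq_ab !inE.
  by do 4![case/orP => /eqP ?]; subst; auto.
exists ((c1, x) :: (x, c2) :: O'); split; last first.
  by move=> y; have := bO y; rewrite !(permP pO) /=; clear; lia.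
rewrite /orients /=.
have hs : perm_eq [seq [set c.1; c.2] | c <- F] ([set x; b] :: [seq [set c.1; c.2] | c <- F2]).
  by rewrite -set_f; apply: (perm_map (fun c : T * T => [set c.1; c.2]) hF2).
rewrite perm_sym; apply: (@perm_trans _ ([set x; a] :: [set x; b] :: [seq [set c.1; c.2] | c <- O'])).
  rewrite perm_cons; apply: perm_trans hs _; by rewrite perm_cons perm_sym.
case: c_ab => -[-> ->]; first by rewrite [[set a; x]]setUC.
rewrite [[set b; x]]setUC.
exact: (permEl (perm_catCA [:: [set x; a]] [:: [set x; b]] _)).
Qed.

End Cuts.

Arguments cut : simpl never.
Arguments en : simpl never.
Arguments nonloops : simpl never.

(** * Local edge-connectivity requirements *)

Lemma count_lt (S : eqType) (a b : pred S) (s : seq S) x :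
  subpred a b -> x \in s -> b x && ~~ a x -> count a s < count b s.
Proof.
move=> sab sx /andP[bx nax]; have /permP h := perm_to_rem sx.
by rewrite !h /= bx (negbTE nax) add0n add1n ltnS sub_count.
Qed.

Section Requirement.
Variable T : finType.
Implicit Types (E M : seq (T * T)) (X Y A B C : {set T}) (x y z : T).

(* Junk when [x = y]: no set separates them. *)
Definition mincut E x y : nat :=
  cut E [arg min_(X < [set x] | (x \in X) && (y \notin X)) cut E X].
Definition req E x y : nat := (mincut E x y)./2.*2.
Definition Req E X : nat :=
  \max_(p : T * T | (p.1 \in X) && (p.2 \notin X)) req E p.1 p.2.

Lemma mincutP E x y : x != y ->
  exists2 X : {set T}, (x \in X) && (y \notin X) & mincut E x y = cut E X.
Proof.
move=> nxy; rewrite /mincut; case: arg_minnP => [|X hX _]; last by exists X.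
by rewrite !inE eqxx eq_sym.
Qed.

Lemma mincut_le E X x y : x \in X -> y \notin X -> mincut E x y <= cut E X.
Proof.
move=> hx hy; rewrite /mincut; case: arg_minnP => [|Y _]; last by apply; rewrite hx.
by rewrite !inE eqxx /=; apply: contraNneq hy => ->.
Qed.

Lemma in_notin_neq X x y : x \in X -> y \notin X -> x != y.
Proof. by move=> hx; apply: contraNneq => <-. Qed.

Lemma mincutC E x y : x != y -> mincut E x y = mincut E y x.
Proof.
wlog suff h : x y / x != y -> mincut E x y <= mincut E y x => [nxy|].
  by apply/eqP; rewrite eqn_leq !h // eq_sym.
rewrite eq_sym => /(mincutP E)[X /andP[hy hx] ->].
by rewrite -cutC; apply: mincut_le; rewrite ?inE ?hy.
Qed.

Lemma reqC E x y : x != y -> req E x y = req E y x.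
Proof. by move=> h; rewrite /req mincutC. Qed.

Lemma odd_req E x y : odd (req E x y) = false.
Proof. exact: odd_double. Qed.

Lemma half_double_le n : n./2.*2 <= n.
Proof. lia. Qed.

Lemma req_le_mincut E x y : req E x y <= mincut E x y.
Proof. exact: half_double_le. Qed.

Lemma le_req E x y k : x != y -> ~~ odd k ->
  (forall X, x \in X -> y \notin X -> k <= cut E X) -> k <= req E x y.
Proof.
move=> nxy ok h; have [X /andP[hx hy] eX] := mincutP E nxy.
by have := h X hx hy; rewrite -eX /req; move: ok; lia.
Qed.

Lemma req_le_cut E X x y : x \in X -> y \notin X -> req E x y <= cut E X.
Proof. by move=> hx hy; apply: leq_trans (req_le_mincut _ _ _) (mincut_le _ hx hy). Qed.

(** A set that separates [x] from [z] separates [y] from one of them. *)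
Lemma req_ultra E x y z : x != y -> y != z -> x != z ->
  minn (req E x y) (req E y z) <= req E x z.
Proof.
move=> xy yz xz; apply: le_req => // [|X hx hz].
  by rewrite /minn; case: ifP; rewrite odd_req.
have [hy|hy] := boolP (y \in X).
  by rewrite geq_min (req_le_cut E hy hz) orbT.
by rewrite geq_min (req_le_cut E hx hy).
Qed.

Lemma req_le_Req E X x y : x \in X -> y \notin X -> req E x y <= Req E X.
Proof.
move=> hx hy; apply: (@leq_bigmax_cond _ _ (fun p : T * T => req E p.1 p.2) (x, y)).
by rewrite /= hx.
Qed.

Lemma ReqP E X x y : x \in X -> y \notin X ->
  exists p q, [/\ p \in X, q \notin X & Req E X = req E p q].
Proof.
move=> hx hy; have : 0 < #|[pred p : T * T | (p.1 \in X) && (p.2 \notin X)]|.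
  by apply/card_gt0P; exists (x, y); rewrite !inE /= hx.
case/(eq_bigmax_cond (fun p => req E p.1 p.2)) => -[p q] /andP[/= hp hq] h.
by exists p, q.
Qed.

Lemma Req_gt0 E X : 0 < Req E X -> exists p q, [/\ p \in X, q \notin X & Req E X = req E p q].
Proof.
move=> h; have [[x y] /andP[/= hx hy]|none] :=
  pickP (fun p : T * T => (p.1 \in X) && (p.2 \notin X)).
  exact: (ReqP E hx hy).
by move: h; rewrite /Req big_pred0.
Qed.

Lemma ReqC E X : Req E (~: X) = Req E X.
Proof.
wlog suff h : X / Req E (~: X) <= Req E X.
  by apply/eqP; rewrite eqn_leq h /= -{1}[X]setCK h.
have [->//|/Req_gt0[p [q []]]] := posnP (Req E (~: X)).
rewrite !inE negbK => hp hq ->; rewrite reqC ?req_le_Req //.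
by rewrite eq_sym (in_notin_neq hq hp).
Qed.

Lemma odd_Req E X : odd (Req E X) = false.
Proof.
have [->//|/Req_gt0[p [q [_ _ ->]]]] := posnP (Req E X); exact: odd_req.
Qed.

Lemma Req_le_cut E X : Req E X <= cut E X.
Proof.
have [->//|/Req_gt0[p [q [hp hq ->]]]] := posnP (Req E X); exact: req_le_cut.
Qed.

Lemma req_le_Req1 E x y : x != y -> req E x y <= Req E [set x].
Proof. by move=> nxy; apply: req_le_Req; rewrite !inE // eq_sym. Qed.

Lemma req_le_Req1r E x y : x != y -> req E x y <= Req E [set y].
Proof. by move=> nxy; rewrite reqC // req_le_Req1 // eq_sym. Qed.

Lemma req_swap_le_Req E X p q : p \notin X -> q \in X -> req E p q <= Req E X.
Proof. by move=> hp hq; rewrite reqC ?req_le_Req // eq_sym (in_notin_neq hq hp). Qed.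

(** Let [p q] and [p' q'] attain the two requirements, that of [X] being the larger. If [Y]
    separates [p] from [q], then so do both sets of one alternative. Otherwise one set of each
    alternative does, and the place of [q'] or [p'] relative to [X] tells which of the two remaining
    sets separates [p'] from [q']. *)
Lemma Req_skew E X Y :
  Req E X + Req E Y <= Req E (X :&: Y) + Req E (X :|: Y) \/
  Req E X + Req E Y <= Req E (X :\: Y) + Req E (Y :\: X).
Proof.
wlog leYX : X Y / Req E Y <= Req E X => [hw|].
  have [/hw //|/ltnW/hw] := leqP (Req E Y) (Req E X).
  by rewrite setIC setUC addnC [X in _ \/ _ <= X]addnC.
have [Y0|Y_gt0] := posnP (Req E Y).
  rewrite Y0 addn0; have [->|/Req_gt0[p [q [hp hq ->]]]] := posnP (Req E X); first by left.
  have [pY|pY] := boolP (p \in Y).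
    left; apply: leq_trans (leq_addr _ _); apply: req_le_Req; rewrite !inE ?hp //.
    by rewrite negb_and hq.
  right; apply: leq_trans (leq_addr _ _); apply: req_le_Req; rewrite !inE ?hp ?pY //.
  by rewrite negb_and hq orbT.
have [p' [q' [hp' hq' eY]]] := Req_gt0 Y_gt0.
have [p [q [hp hq eX]]] := Req_gt0 (leq_trans Y_gt0 leYX).
rewrite eX eY.
have leYX' : req E p' q' <= req E p q by rewrite -eX -eY.
have [pY|pY] := boolP (p \in Y); have [qY|qY] := boolP (q \in Y).
- have h1 : req E p q <= Req E (X :&: Y) by apply: req_le_Req; rewrite !inE ?hp // (negbTE hq).
  have h2 : req E p q <= Req E (Y :\: X) by apply: req_swap_le_Req; rewrite !inE ?hp //= hq.
  have [qX|qX] := boolP (q' \in X).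
    right; rewrite addnC leq_add //.
    by apply: req_swap_le_Req; rewrite !inE ?hp' ?hq'.
  left; rewrite leq_add //; apply: req_le_Req; rewrite !inE ?hp' ?orbT //.
  by rewrite negb_or qX.
- left; rewrite leq_add //; [|apply: leq_trans leYX' _]; apply: req_le_Req;
  by rewrite !inE ?hp ?pY ?negb_and ?negb_or ?hq ?qY.
- right; rewrite leq_add //; [|apply: leq_trans leYX' _].
    by apply: req_le_Req; rewrite !inE ?hp ?pY //= negb_and qY.
  by apply: req_swap_le_Req; rewrite !inE ?hp //= ?hq ?qY.
- have h1 : req E p q <= Req E (X :\: Y) by apply: req_le_Req; rewrite !inE ?hp ?pY //= (negbTE hq) andbF.
  have h2 : req E p q <= Req E (X :|: Y) by apply: req_le_Req; rewrite !inE ?hp //= negb_or hq.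
  have [pX|pX] := boolP (p' \in X).
    left; rewrite addnC leq_add //.
    by apply: req_le_Req; rewrite !inE ?hp' ?pX //= negb_and hq' orbT.
  right; rewrite leq_add //; apply: req_le_Req; rewrite !inE ?hp' ?pX //=.
  by rewrite negb_and hq' orbT.
Qed.

(** * Pairings and contraction *)

Definition pairing E M : Prop :=
  (forall X, odd (cut M X) = odd (cut E X)) /\
  (forall X, cut M X + Req E X <= cut E X).

Definition pairable E : Prop := exists M, pairing E M.

Lemma pairing_deg1 E : pairable E ->
  exists2 M, pairing E M & forall x, cut M [set x] <= 1.
Proof.
case=> M [oM rM]; have [M' [o' le' d']] := shortcut M.
exists M' => //; split=> X; first by rewrite o'.
by apply: leq_trans (rM X); rewrite leq_add2r.
Qed.

Definition contract (f : T -> T) E : seq (T * T) := [seq (f e.1, f e.2) | e <- E].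

Lemma cut_contract f E X : cut (contract f E) X = cut E (f @^-1: X).
Proof. by rewrite /cut count_map; apply: eq_count => e; rewrite /crosses /= !inE. Qed.

(** Every cut of the contracted graph pulls back to a cut of [E], so contraction cannot lower local
    connectivity. *)
Lemma Req_contract f E X : Req E (f @^-1: X) <= Req (contract f E) X.
Proof.
have [->//|/Req_gt0[p [q []]]] := posnP (Req E (f @^-1: X)).
rewrite !inE => hp hq ->; apply: leq_trans (req_le_Req _ hp hq).
apply: le_req => [||Y pY qY]; first exact: in_notin_neq hp hq.
  by rewrite odd_req.
by rewrite cut_contract; apply: req_le_cut; rewrite inE.
Qed.

Definition indep E X : bool :=
  all (fun e => [|| e.1 == e.2, e.1 \notin X | e.2 \notin X]) E.

(* The pairing of a graph in which [~: X] is contracted to one vertex [w],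
   seen on the subsets of [X]. *)
Lemma contract_pairing E X w : (forall E', nonloops E' < nonloops E -> pairable E') ->
  w \notin X -> ~~ indep E (~: X) ->
  exists M, [/\ forall A, A \subset X -> odd (cut M A) = odd (cut E A),
    forall A, A \subset X -> cut M A + Req E A <= cut E A &
    forall x, cut M [set x] <= 1].
Proof.
move=> IH hw /allPn[e Ee]; rewrite !inE !negb_or !negbK => /and3P[ne e1 e2].
pose f x := if x \in X then x else w.
(* The edge with distinct ends outside [X] becomes a loop at [w]. *)
have lt : nonloops (contract f E) < nonloops E.
  rewrite /nonloops /contract count_map; apply: (count_lt (x := e)) => //= [a|].
    by apply: contraNneq => ->.
  by rewrite ne /f (negbTE e1) (negbTE e2) eqxx.
have [M [oM rM] dM] := pairing_deg1 (IH _ lt).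
have fA A : A \subset X -> f @^-1: A = A.
  move=> sAX; apply/setP=> x; rewrite inE /f; case: ifP => // hx.
  by rewrite (contraNF (subsetP sAX w)) // (contraFF (subsetP sAX x)).
exists M; split=> // A sAX.
  by rewrite oM cut_contract fA.
have := rM A; rewrite cut_contract (fA _ sAX).
by have := Req_contract f E A; rewrite fA //; lia.
Qed.

End Requirement.

(** * Restricting pairings to one side of a cut, and extending cut bounds *)

Section Inside.
Variable T : finType.
Implicit Types (E M : seq (T * T)) (X Y A B C K : {set T}) (x y z : T).

Definition inside X M : seq (T * T) := [seq e <- M | (e.1 \in X) && (e.2 \in X)].

Lemma cut_inside M X Y : cut M (Y :&: X) = cut (inside X M) Y +
  count (fun e => crosses X e && ((e.1 \in X :&: Y) || (e.2 \in X :&: Y))) M.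
Proof.
rewrite /cut /inside count_filter; elim: M => //= e M; rewrite /crosses !inE.
by case: (e.1 \in X); case: (e.2 \in X); case: (e.1 \in Y); case: (e.2 \in Y) => /=; lia.
Qed.

Lemma cut_inside0 M X Y : cut M X = 0 -> cut M (Y :&: X) = cut (inside X M) Y.
Proof.
move=> c0; rewrite cut_inside; set n := count _ _.
suff : n <= cut M X by lia.
by apply: sub_count => e /andP[].
Qed.

(** For gluing two pairings across a cut: the one edge of [M] leaving [X] is cut open at its inner
    end [a], to be joined later to an end on the other side. *)
Lemma cut_inside1 M X : cut M X = 1 ->
  exists2 a, a \in X & forall Y, cut M (Y :&: X) = cut (inside X M) Y + (a \in Y).
Proof.
move=> c1; have /hasP[e Me ce] : has (crosses X) M by rewrite has_count -/(cut M X) c1.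
have pM := perm_to_rem Me; set M' := rem e M in pM.
have c0 : cut M' X = 0 by move: c1; rewrite (cut_perm _ pM) cut_cons ce; lia.
pose a := if e.1 \in X then e.1 else e.2.
have aX : a \in X.
  by move: ce; rewrite /a /crosses; case: ifP => //= ->.
exists a => // Y; rewrite cut_inside; congr (_ + _).
have /permP -> := pM; rewrite /= ce /= !inE.
have -> : count (fun e => crosses X e && ((e.1 \in X :&: Y) || (e.2 \in X :&: Y))) M' = 0.
  by apply/eqP; rewrite -leqn0 -c0; apply: sub_count => e' /andP[].
move: ce; rewrite addn0 /crosses /a.
by case: (e.1 \in X); case: (e.2 \in X); rewrite //= orbF.
Qed.

Lemma en_eq0 E A B : [disjoint A & B] ->
  (forall x y, x \in A -> y \in B -> en E [set x] [set y] = 0) -> en E A B = 0.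
Proof.
move=> dAB h; apply/eqP; apply: contraT; rewrite -lt0n.
case/(edge_at dAB) => x [y [E' [hx hy _ hen _]]]; have := h x y hx hy.
by rewrite hen /en /= !inE !eqxx.
Qed.

Lemma indep_en E X A B : indep E X -> [disjoint A & B] -> A \subset X -> B \subset X ->
  en E A B = 0.
Proof.
move=> /allP iX dAB sA sB; apply/eqP; rewrite addn_eq0 !eqn0Ngt -!has_count.
apply/andP; split; apply/hasPn => -[x y] /iX /=; rewrite negb_and.
  case/or3P=> [/eqP->|h|h].
  - by rewrite -negb_and; apply/andP => -[hy]; rewrite (disjointFr dAB).
  - by rewrite (contra (subsetP sA x)).
  - by rewrite (contra (subsetP sB y)) ?orbT.
case/or3P=> [/eqP->|h|h].
- by rewrite -negb_and; apply/andP => -[hy]; rewrite (disjointFl dAB).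
- by rewrite (contra (subsetP sB x)).
- by rewrite (contra (subsetP sA y)) ?orbT.
Qed.

(** As [Req E] takes even values, rounding the minimum cuts of [E'] down to even numbers loses
    nothing. *)
Lemma Req_mono E E' : (forall X, Req E X <= cut E' X) -> forall X, Req E X <= Req E' X.
Proof.
move=> h X; have [->//|/Req_gt0[p [q [hp hq ->]]]] := posnP (Req E X).
apply: leq_trans (req_le_Req _ hp hq); apply: le_req => [||Y pY qY].
- exact: in_notin_neq hp hq.
- by rewrite odd_req.
- by apply: leq_trans (h Y); apply: req_le_Req.
Qed.

Lemma disj_set1 A x : x \notin A -> [disjoint A & [set x]].
Proof. by move=> h; rewrite disjoints_subset; apply/subsetP=> y hy; rewrite !inE; apply: contraNneq h => <-. Qed.

Lemma disj_D1 A x : [disjoint [set x] & A :\ x].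
Proof. by rewrite disjoint_sym disj_set1 // !inE eqxx. Qed.

Lemma cutD1 E A x : x \in A -> cut E A + (en E [set x] (A :\ x)).*2 = cut E [set x] + cut E (A :\ x).
Proof. by move=> hx; rewrite -cutU ?disj_D1 // setD1K. Qed.

(** The vertices of [K] are added one by one. Such a [z] raises the cut of [E] by its degree minus
    twice its edges to [A], a nonnegative number with the parity of the degree; so the rise is at
    least the number, 0 or 1, of edges of [M] at [z]. *)
Lemma cut_extend E M A K : [disjoint A & K] ->
  {in K, forall z, odd (cut M [set z]) = odd (cut E [set z])} ->
  {in K, forall z, cut M [set z] <= 1} ->
  {in K &, forall z z', z != z' -> en E [set z] [set z'] = 0} ->
  {in K, forall z, (en E [set z] A).*2 <= cut E [set z]} ->
  cut M (A :|: K) + cut E A <= cut E (A :|: K) + cut M A.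
Proof.
have [n] := ubnP #|K|; elim: n K => // n IH K; rewrite ltnS => leK dAK oM dM iK hA.
have [->|[z Kz]] := set_0Vmem K; first by rewrite setU0 addnC.
have sK' : K :\ z \subset K by rewrite subsetDl.
have ltK : #|K :\ z| < n by move: leK; rewrite (cardsD1 z) Kz.
have := IH _ ltK (disjointWr sK' dAK) (sub_in1 (subsetP sK') oM)
  (sub_in1 (subsetP sK') dM) (sub_in2 (subsetP sK') iK) (sub_in1 (subsetP sK') hA).
have zA : z \notin A by rewrite (disjointFl dAK Kz).
have zAK : z \notin A :|: K :\ z by rewrite !inE eqxx (negbTE zA).
have -> : A :|: K = (A :|: K :\ z) :|: [set z] by rewrite -setUA [_ :|: [set z]]setUC setD1K.
have := cutU E (disj_set1 zAK); have := cutU_le M (A :|: K :\ z) [set z].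
rewrite enC enU; last by rewrite (disjointWr sK').
have -> : en E [set z] (K :\ z) = 0.
  apply: en_eq0; first exact: disj_D1.
  by move=> _ y /set1P -> /setD1P[nyz Ky]; rewrite iK // eq_sym.
have := oM z Kz; have := dM z Kz; have := hA z Kz.
clear; lia.
Qed.

End Inside.

(** * Tight sets and slack vertices in a minimal counterexample *)

Section MinimalCounterexample.
Variables (T : finType) (E : seq (T * T)).
Hypothesis IH : forall E' : seq (T * T), nonloops E' < nonloops E -> pairable E'.
Hypothesis npE : ~ pairable E.
Implicit Types (M : seq (T * T)) (X Y A B C K : {set T}) (x y z : T).

Local Notation d := (cut E).
Local Notation R := (Req E).
Local Notation r := (req E).
Local Notation e := (en E).

Definition tight X := R X == d X.

Lemma edge_tight x y : x != y -> 0 < e [set x] [set y] ->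
  exists2 X, crosses X (x, y) & tight X.
Proof.
move=> nxy; have dxy : [disjoint [set x] & [set y]] by rewrite disj_set1 // inE eq_sym.
case/(edge_at dxy) => _ [_ [E' [/set1P -> /set1P -> cE eE nE]]].
have [/existsP[X /andP[hX tX]]|/existsPn none] :=
  boolP [exists X, crosses X (x, y) && tight X]; first by exists X.
exfalso; apply: npE.
have le X : R X <= cut E' X.
  have := none X; rewrite negb_and /tight; have := Req_le_cut E X; rewrite cE.
  by case: (crosses X (x, y)) => /=; clear; lia.
have [M [oM rM]] := IH (E' := E') ltac:(by rewrite nE).
exists ((x, y) :: M); split=> X; first by rewrite cut_cons cE !oddD oM.
by rewrite cut_cons cE -addnA leq_add2l; have := rM X; have := Req_mono le X; lia.
Qed.

Lemma tight_indep X : tight X -> indep E X || indep E (~: X).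
Proof.
move=> /eqP tX; apply: contraT; rewrite negb_or => /andP[iX iXc]; exfalso; apply: npE.
have /allPn[[w1 w'] _ /=] := iX; rewrite !negb_or !negbK => /and3P[_ w1X _].
have /allPn[[w2 w''] _ /=] := iXc; rewrite !negb_or !negbK !inE => /and3P[_ w2X _].
have [M1 [o1 r1 _]] := contract_pairing IH w2X iXc.
have := @contract_pairing _ E (~: X) w1 IH; rewrite setCK inE negbK.
move=> /(_ w1X iX) [M2 [o2 r2 _]].
(* Tightness leaves no room for an edge of either pairing across [X]. *)
have c1 : cut M1 X = 0 by have := r1 X (subxx _); lia.
have c2 : cut M2 (~: X) = 0 by have := r2 _ (subxx _); rewrite ReqC !cutC; lia.
exists (inside X M1 ++ inside (~: X) M2).
have hM Y : cut (inside X M1 ++ inside (~: X) M2) Y = cut M1 (Y :&: X) + cut M2 (Y :&: ~: X).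
  by rewrite cut_cat !cut_inside0.
split=> Y.
  rewrite hM oddD o1 ?subsetIr // o2 ?subsetIr // -odd_cutU.
    by rewrite -setIUr setUCr setIT.
  by rewrite -setI_eq0 setIACA setICr setI0.
(* Inside [X] the glued pairing has the same cut at [Y] and at its complement, and likewise outside
   [X]. So its cut at [Y] can be charged to either diagonal pair of corners of [X] and [Y],
   whichever [Req_skew] offers. *)
have h1 := r1 _ (subsetIr Y X); have h2 := r2 _ (subsetIr Y (~: X)).
have h3 := r1 _ (subsetIr (~: Y) X); have h4 := r2 _ (subsetIr (~: Y) (~: X)).
have hMc := hM (~: Y); rewrite cutC in hMc.
have e1 : cut (inside X M1) Y = cut M1 (~: Y :&: X) by rewrite cut_inside0 // cutC.
have e2 : cut (inside (~: X) M2) Y = cut M2 (~: Y :&: ~: X) by rewrite cut_inside0 // cutC.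
have e3 : cut (inside X M1) Y = cut M1 (Y :&: X) by rewrite cut_inside0.
have e4 : cut (inside (~: X) M2) Y = cut M2 (Y :&: ~: X) by rewrite cut_inside0.
rewrite hM; move: h1 h2 h3 h4; rewrite -e2 -e4 -e1 -e3.
rewrite [~: Y :&: X]setIC [Y :&: X]setIC -!setDE.
have -> : ~: Y :\: X = ~: (X :|: Y) by rewrite setCU setDE setIC.
rewrite ReqC cutC; have := cut_submod E X Y; have := cut_posimod E X Y.
by move: tX; case: (Req_skew E X Y); clear; lia.
Qed.

(** Up to isolated vertices, [X] is empty or a single tight vertex. *)
Definition thin X := forall u, u \in X -> 0 < d [set u] ->
  [/\ tight [set u], d X = d [set u] & forall w, w \in X -> 0 < d [set w] -> w = u].

Lemma indep_le X u : indep E X -> u \in X -> d [set u] <= d X.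
Proof.
move=> iX uX; have := cutD1 E uX.
by rewrite (indep_en iX) ?disj_D1 ?subsetDl ?sub1set //; lia.
Qed.

Lemma indepS X Y : X \subset Y -> indep E Y -> indep E X.
Proof.
move=> sXY; apply: sub_all => a /or3P[->//|h|h].
  by rewrite (contra (subsetP sXY _) h) orbT.
by rewrite (contra (subsetP sXY _) h) !orbT.
Qed.

(** Let [p] in [X] attain the requirement of [X]. Then [d [set p]] is at least [R X = d X], while in
    an independent set the degrees add up to the cut; so all other vertices of [X] are isolated. *)
Lemma indep_thin X : tight X -> indep E X -> thin X.
Proof.
move=> /eqP tX iX u uX du.
have [p [q [pX qX eR]]] : exists p q, [/\ p \in X, q \notin X & R X = r p q].
  by apply: Req_gt0; have := indep_le iX uX; lia.
have := cutD1 E pX; rewrite (indep_en iX) ?disj_D1 ?subsetDl ?sub1set //.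
have le1 := req_le_Req1 E (in_notin_neq pX qX).
have le2 := Req_le_cut E [set p] => eqd.
have d0 : d (X :\ p) = 0 by lia.
have z0 w : w \in X -> 0 < d [set w] -> w = p.
  move=> wX; apply: contraTeq => nwp; rewrite -eqn0Ngt -leqn0 -d0.
  by apply: indep_le; rewrite ?inE ?nwp // (indepS _ iX) ?subsetDl.
have -> := z0 u uX du; split=> //; last lia.
by rewrite /tight; lia.
Qed.

Lemma tight_thin X : tight X -> thin X \/ thin (~: X).
Proof.
move=> tX; case/orP: (tight_indep tX) => iX; [left|right]; apply: indep_thin => //.
by rewrite /tight ReqC cutC.
Qed.

Lemma edge_deg x y : x != y -> 0 < e [set x] [set y] -> 0 < d [set x].
Proof. by move=> nxy h; apply: leq_trans h (en_le_cut _ _); rewrite disj_set1 // inE eq_sym. Qed.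

(** The tight set separating the ends is thin on one side, and the end lying on that side is its
    tight vertex. *)
Lemma edge_tight_end x y : x != y -> 0 < e [set x] [set y] ->
  tight [set x] \/ tight [set y].
Proof.
move=> nxy exy; have [X cX tX] := edge_tight nxy exy.
have dx := edge_deg nxy exy.
have dy : 0 < d [set y] by apply: (@edge_deg y x); rewrite 1?eq_sym // enC.
move: cX; rewrite /crosses /=; case: (tight_thin tX) => th.
- case xX: (x \in X) => /=.
    by move=> _; left; have [] := th x xX dx.
  by move=> yX; right; have [] := th y yX dy.
- case xX: (x \in X) => /= yX.
    by right; have [] := th y _ dy; rewrite ?inE.
  by left; have [] := th x _ dx; rewrite ?inE ?xX.
Qed.

(** The vertices that are not tight of positive degree. Isolated vertices are tight but are counted
    as slack, since they do not disturb independence. *)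
Definition slack z := (d [set z] == 0) || (R [set z] < d [set z]).

Lemma slack_nonadj x y : x != y -> slack x -> slack y -> e [set x] [set y] = 0.
Proof.
move=> nxy sx sy; apply/eqP; apply: contraT; rewrite -lt0n => exy.
have dx := edge_deg nxy exy.
have dy : 0 < d [set y] by apply: (@edge_deg y x); rewrite 1?eq_sym // enC.
by move: sx sy; rewrite /slack; case: (edge_tight_end nxy exy) => /eqP ->; lia.
Qed.

(** [Y] is independent, so [cut_extend] from the empty set gives the bound without the requirement.
    A vertex [p] attaining [R Y] has degree above [R [set p]], an even number, which leaves room for
    the at most one edge of [M] at [p]. *)
Lemma slack_bound M Y : (forall X, odd (cut M X) = odd (d X)) ->
  (forall z, cut M [set z] <= 1) -> {in Y, forall z, slack z} -> cut M Y + R Y <= d Y.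
Proof.
move=> oM dM sY.
have base K : K \subset Y -> cut M K <= d K.
  move=> sKY; have := @cut_extend _ E M set0 K; rewrite !set0U !cut0 addn0 addn0; apply.
  - by rewrite disjoints_subset sub0set.
  - by move=> z _; apply: oM.
  - by move=> z _; apply: dM.
  - by move=> z z' Kz Kz' nz; apply: slack_nonadj => //; apply: sY; apply: (subsetP sKY).
  - by move=> z _; rewrite en0.
have [R0|/Req_gt0[p [q [pY qY eR]]]] := posnP (R Y); first by rewrite R0 addn0 base.
have := cutD1 E pY; rewrite en_eq0 ?disj_D1 //; last first.
  move=> _ y /set1P -> /setD1P[ny Yy]; apply: slack_nonadj; rewrite 1?eq_sym //; exact: sY.
have := cutU_le M [set p] (Y :\ p); rewrite setD1K //.
have := base (Y :\ p) (subsetDl _ _).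
have := req_le_Req1 E (in_notin_neq pY qY).
have := sY p pY; rewrite /slack; have := dM p; have := oM [set p].
have := Req_le_cut E [set p]; have := odd_Req E [set p].
clear -eR; lia.
Qed.

Lemma exists_tight : exists s, tight [set s] && (0 < d [set s]).
Proof.
have [n0|] := posnP (nonloops E).
  exfalso; apply: npE; exists [::].
  have c0 X : d X = 0.
    apply/eqP; rewrite -leqn0 -n0; apply: sub_count => a.
    by rewrite /crosses; apply: contraTneq => ->; rewrite addbb.
  by split=> X; have := Req_le_cut E X; rewrite c0 ?leqn0 // => /eqP ->.
rewrite -has_count => /hasP[[x y] Exy /= nxy].
have exy : 0 < e [set x] [set y].
  rewrite /en addn_gt0 -has_count; apply/orP; left; apply/hasP.
  by exists (x, y); rewrite //= !inE !eqxx.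
have dx := edge_deg nxy exy.
have dy : 0 < d [set y] by apply: (@edge_deg y x); rewrite 1?eq_sym // enC.
by case: (edge_tight_end nxy exy) => ht; [exists x | exists y]; rewrite ht.
Qed.

(** * Cuts with one edge more than their requirement *)

Section Level.
Variable k : nat.
Hypothesis k_low : forall z, tight [set z] -> 0 < d [set z] -> k < d [set z].
Hypothesis req_high : forall p q, p != q -> k < R [set p] -> k < R [set q] -> k <= r p q.

Lemma low_slack z : R [set z] <= k -> slack z.
Proof.
rewrite /slack => Rz; have := Req_le_cut E [set z]; have := @k_low z; rewrite /tight; lia.
Qed.

(** Both sides of [X] are contracted. By parity each of the two pairings has exactly one edge across
    [X]; cutting these open at [a] and [b] and adding [ab] to the inner parts yields a pairing of
    [E]. Sets with a vertex of requirement above [k] on both sides are uncrossed with [X]; the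
    others fall under [slack_bound]. *)
Lemma near_tight_absurd X x y : x \in X -> y \notin X -> k < R [set x] -> k < R [set y] ->
  R X = k -> d X = k.+1 -> (forall A, x \in A -> y \notin A -> k < d A) -> False.
Proof.
move=> xX yX Rx Ry RX dX noA.
have ek : odd k = false by rewrite -RX odd_Req.
(* As [k] is even, [R [set u]] is at least [k + 2], too much for a vertex of an independent set with
   [k + 1] edges leaving it. *)
have nindep A u : u \in A -> k < R [set u] -> d A = k.+1 -> ~~ indep E A.
  move=> uA Ru dA; apply/negP => iA; have := indep_le iA uA.
  by have := Req_le_cut E [set u]; have := odd_Req E [set u]; move: Ru dA ek; clear; lia.
have yXc : y \in ~: X by rewrite inE.
have iX := nindep X x xX Rx dX.
have iXc : ~~ indep E (~: X) by apply: (nindep _ y); rewrite // cutC.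
have [M1 [o1 r1 d1]] := contract_pairing IH yX iXc.
have := @contract_pairing _ E (~: X) x IH; rewrite setCK inE negbK.
move=> /(_ xX iX) [M2 [o2 r2 d2]].
have c1 : cut M1 X = 1.
  by have := r1 X (subxx _); have := o1 X (subxx _); rewrite dX RX /= ek; clear; lia.
have c2 : cut M2 (~: X) = 1.
  have := r2 _ (subxx _); have := o2 _ (subxx _).
  by rewrite ReqC !cutC dX RX /= ek; clear; lia.
have [a aX h1] := cut_inside1 c1; have [b bX h2] := cut_inside1 c2.
pose c1' Y := cut (inside X M1) Y; pose c2' Y := cut (inside (~: X) M2) Y.
pose M := (a, b) :: inside X M1 ++ inside (~: X) M2.
have hM Y : cut M Y = crosses Y (a, b) + (c1' Y + c2' Y) by rewrite cut_cons cut_cat.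
have c1C Y : c1' (~: Y) = c1' Y by apply: cutC.
have c2C Y : c2' (~: Y) = c2' Y by apply: cutC.
have oM Y : odd (cut M Y) = odd (d Y).
  have -> : odd (d Y) = odd (d (Y :&: X)) (+) odd (d (Y :&: ~: X)).
    rewrite -odd_cutU -?setIUr ?setUCr ?setIT //.
    by rewrite -setI_eq0 setIACA setICr setI0.
  rewrite -o1 ?subsetIr // -o2 ?subsetIr // h1 h2 hM.
  by rewrite -/(c1' _) -/(c2' _) /crosses /=; case: (a \in Y); case: (b \in Y); clear; lia.
have dMX A : A \subset X -> cut M A = cut M1 A.
  move=> sA; have := h1 A; have := h2 A; rewrite (setIidPl sA) hM -/(c1' A) -/(c2' A).
  have -> : A :&: ~: X = set0 by apply/eqP; rewrite -setDE setD_eq0.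
  by rewrite cut0 /crosses /=; case: (a \in A); case: (b \in A) => /=; clear; lia.
have dMXc A : A \subset ~: X -> cut M A = cut M2 A.
  move=> sA; have := h1 A; have := h2 A; rewrite (setIidPl sA) hM -/(c1' A) -/(c2' A).
  have -> : A :&: X = set0 by apply/eqP; rewrite setI_eq0 disjoints_subset.
  by rewrite cut0 /crosses /=; case: (a \in A); case: (b \in A) => /=; clear; lia.
(* Moving a low vertex across [X] gives a set that still separates [x] from [y], hence has at least
   [k + 1 = d X] edges; so at most half of the edges at [z] lead to the other side. *)
have zout z : R [set z] <= k -> z \notin X -> (e [set z] X).*2 <= d [set z].
  move=> Rz zX; have := cutU E (disj_set1 zX); rewrite enC.
  have : k < d (X :|: [set z]).
    apply: noA; rewrite !inE ?xX // negb_or yX /=.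
    by apply: contraTneq Rz => <-; rewrite -ltnNge.
  move: dX; clear; lia.
have zin z : R [set z] <= k -> z \in X -> (e [set z] (~: X)).*2 <= d [set z].
  move=> Rz zX; have zXc : z \notin ~: X by rewrite inE zX.
  have := cutU E (disj_set1 zXc); rewrite enC cutC.
  have : k < d (~: (~: X :|: [set z])).
    apply: noA; rewrite !inE ?yX ?negb_or ?xX //=.
    by apply: contraTneq Rz => <-; rewrite -ltnNge.
  rewrite cutC; move: dX; clear; lia.
(* If a and b are on the same side of Y, uncrossing X and Y in either way
   gains the edge ab; here only the differences X \ Y and Y \ X do. *)
have main Y p q : a \notin Y -> b \in Y -> p \in Y -> q \notin Y ->
    k < R [set p] -> k < R [set q] -> cut M Y + r p q <= d Y.
  move=> aY bY pY qY Rp Rq.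
  have [/existsP[h' /and3P[h'Y h'X Rh']]|/existsPn no2] :=
    boolP [exists h', [&& h' \in Y, h' \notin X & k < R [set h']]].
    have [/existsP[h /and3P[hY hX Rh]]|/existsPn no1] :=
      boolP [exists h, [&& h \notin Y, h \in X & k < R [set h]]].
      (* Both differences separate [h] from [h'] and so have requirement at least [k = R X]. This
         stands in for skew supermodularity, which might have offered the other alternative. *)
      have RXY : R (X :\: Y) >= k.
        apply: leq_trans (req_high (in_notin_neq hX h'X) Rh Rh') (req_le_Req _ _ _);
        by rewrite !inE ?hX ?hY ?h'Y.
      have RYX : R (Y :\: X) >= k.
        apply: leq_trans (req_high (in_notin_neq hX h'X) Rh Rh') _.
        by apply: req_swap_le_Req; rewrite !inE ?hX ?hY ?h'Y ?h'X.
      have Rsum : k + r p q <= R (X :\: Y) + R (Y :\: X).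
        have [pX|pX] := boolP (p \in X); have [qX|qX] := boolP (q \in X).
        - have : r p q <= R (X :\: Y) by apply: req_swap_le_Req; rewrite !inE ?pY ?qX ?qY.
          move: RXY RYX; clear; lia.
        - have : r p q <= R X by apply: req_le_Req.
          move: RX RXY RYX; clear; lia.
        - have : r p q <= R X by apply: req_swap_le_Req.
          move: RX RXY RYX; clear; lia.
        - have : r p q <= R (Y :\: X) by apply: req_le_Req; rewrite !inE ?pX ?pY //= (negbTE qY) andbF.
          move: RXY RYX; clear; lia.
      have := r1 (X :\: Y) (subsetDl _ _).
      have := r2 (Y :&: ~: X) (subsetIr _ _); rewrite h2 -setDE.
      have := h1 (~: Y); rewrite [~: Y :&: X]setIC -setDE -/(c1' _) c1C !inE aY => ->.
      rewrite bY hM -/(c2' Y) /crosses /= bY (negbTE aY) /=.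
      have := cut_posimod E X Y; move: Rsum dX RX; clear; lia.
    (* Now one difference consists of low vertices: the bound known for the corner [A], on one side
       of [X], is carried over to the complement of [Y] by [cut_extend]. *)
    have K_low z : z \in X :\: Y -> R [set z] <= k.
      by rewrite inE => /andP[zY zX]; have := no1 z; rewrite zY zX /= -leqNgt.
    pose A := ~: (X :|: Y).
    have AK : ~: Y = A :|: (X :\: Y).
      by rewrite /A setCU setDE -setIUl [~: X :|: X]setUC setUCr setTI.
    have sA : A \subset ~: X by rewrite /A setCU subsetIl.
    have qA : q \in A.
      by rewrite !inE negb_or qY andbT; have := no1 q; rewrite qY Rq /= andbT.
    have pA : p \notin A by rewrite !inE pY orbT.
    have : cut M (A :|: (X :\: Y)) + d A <= d (A :|: (X :\: Y)) + cut M A.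
      apply: cut_extend.
      - by rewrite /A -setI_eq0 setCU setDE setIACA [~: X :&: X]setIC setICr set0I.
      - by move=> z _; apply: oM.
      - by move=> z; rewrite inE => /andP[_ zX]; rewrite dMX ?sub1set.
      - by move=> z z' Kz Kz' nz; apply: slack_nonadj => //; apply: low_slack; apply: K_low.
      - move=> z Kz; have := K_low z Kz; move: Kz; rewrite inE => /andP[_ zX] Rz.
        by apply: leq_trans (zin z Rz zX); rewrite leq_double enS.
    rewrite -AK (dMXc _ sA) (cutC M Y) (cutC E Y); have := r2 A sA.
    have : r p q <= R A by apply: req_swap_le_Req.
    clear; lia.
  have K_low z : z \in Y :\: X -> R [set z] <= k.
    by rewrite inE => /andP[zX zY]; have := no2 z; rewrite zY zX /= -leqNgt.
  pose A := Y :&: X.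
  have AK : Y = A :|: (Y :\: X) by rewrite /A setID.
  have sA : A \subset X by rewrite subsetIr.
  have pA : p \in A.
    by rewrite !inE pY /=; have := no2 p; rewrite pY Rp /= andbT negbK.
  have qA : q \notin A by rewrite !inE (negbTE qY).
  have : cut M (A :|: (Y :\: X)) + d A <= d (A :|: (Y :\: X)) + cut M A.
    apply: cut_extend.
    - by rewrite /A -setI_eq0 setDE setIACA setICr setI0.
    - by move=> z _; apply: oM.
    - by move=> z; rewrite inE => /andP[zX _]; rewrite dMXc ?sub1set ?inE.
    - by move=> z z' Kz Kz' nz; apply: slack_nonadj => //; apply: low_slack; apply: K_low.
    - move=> z Kz; have := K_low z Kz; move: Kz; rewrite inE => /andP[zX _] Rz.
      by apply: leq_trans (zout z Rz zX); rewrite leq_double enS.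
  rewrite -AK (dMX _ sA); have := r1 A sA.
  have : r p q <= R A by apply: req_le_Req.
  clear; lia.
have bound Y h h' : h \in Y -> h' \notin Y -> k < R [set h] -> k < R [set h'] ->
    cut M Y + R Y <= d Y.
  move=> hY h'Y Rh Rh'.
  have kh := req_high (in_notin_neq hY h'Y) Rh Rh'.
  (* If an end of a pair attaining [R Y] has requirement at most [k], then [R Y <= k] and the pair
     [h], [h'] serves instead. *)
  have [p [q [pY qY Rp Rq eR]]] : exists p q, [/\ p \in Y, q \notin Y, k < R [set p],
      k < R [set q] & R Y <= r p q].
    have [p [q [pY qY eR]]] := ReqP E hY h'Y.
    have le1 := req_le_Req1 E (in_notin_neq pY qY).
    have le2 := req_le_Req1r E (in_notin_neq pY qY).
    have [Rp|Rp] := ltnP k (R [set p]); last by exists h, h'; split=> //; move: eR le1 Rp kh; clear; lia.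
    have [Rq|Rq] := ltnP k (R [set q]); last by exists h, h'; split=> //; move: eR le2 Rq kh; clear; lia.
    by exists p, q; split=> //; rewrite eR.
  have [aY|aY] := boolP (a \in Y); have [bY|bY] := boolP (b \in Y).
  - have := Req_skew E X Y; have := cut_submod E X Y; have := cut_posimod E X Y.
    have := r1 (Y :&: X) (subsetIr _ _); have := r2 (Y :&: ~: X) (subsetIr _ _).
    have := r1 (~: Y :&: X) (subsetIr _ _); have := r2 (~: Y :&: ~: X) (subsetIr _ _).
    rewrite !h1 !h2 -/(c1' _) -/(c2' _) -/(c1' _) -/(c2' _) c1C c2C hM /crosses /= !inE aY bY /=.
    rewrite [~: Y :&: X]setIC [Y :&: X]setIC -!setDE.
    have -> : ~: Y :\: X = ~: (X :|: Y) by rewrite setCU setDE setIC.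
    rewrite ReqC cutC; move: dX RX; clear; lia.
  - have := @main (~: Y) q p; rewrite !inE aY bY pY qY !cutC => /(_ isT isT isT isT Rq Rp).
    by rewrite reqC ?(in_notin_neq pY qY) 1?eq_sym ?(in_notin_neq pY qY) //; move: eR; clear; lia.
  - by have := main Y p q aY bY pY qY Rp Rq; move: eR; clear; lia.
  - have := Req_skew E X Y; have := cut_submod E X Y; have := cut_posimod E X Y.
    have := r1 (Y :&: X) (subsetIr _ _); have := r2 (Y :&: ~: X) (subsetIr _ _).
    have := r1 (~: Y :&: X) (subsetIr _ _); have := r2 (~: Y :&: ~: X) (subsetIr _ _).
    rewrite !h1 !h2 -/(c1' _) -/(c2' _) -/(c1' _) -/(c2' _) c1C c2C hM /crosses /= !inE.
    rewrite (negbTE aY) (negbTE bY) /=.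
    rewrite [~: Y :&: X]setIC [Y :&: X]setIC -!setDE.
    have -> : ~: Y :\: X = ~: (X :|: Y) by rewrite setCU setDE setIC.
    rewrite ReqC cutC; move: dX RX; clear; lia.
(* Shortcutting restores degrees at most one, which [slack_bound] needs. *)
have [M' [o' le' deg']] := shortcut M.
apply: npE; exists M'; split=> Y; first by rewrite o'.
have {}o' Z : odd (cut M' Z) = odd (d Z) by rewrite o'.
have [/existsP[h /andP[hY Rh]]|/existsPn no1] := boolP [exists h, (h \in Y) && (k < R [set h])].
  have [/existsP[h' /andP[h'Y Rh']]|/existsPn no2] :=
      boolP [exists h, (h \notin Y) && (k < R [set h])].
    by have := bound Y h h' hY h'Y Rh Rh'; have := le' Y; clear; lia.
  rewrite -(cutC M') -ReqC -(cutC E); apply: slack_bound => // z; rewrite inE => zY.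
  by apply: low_slack; have := no2 z; rewrite zY /= -leqNgt.
apply: slack_bound => // z zY.
by apply: low_slack; have := no1 z; rewrite zY /= -leqNgt.
Qed.

End Level.

(** A violating pair with [k = r x y] least satisfies the hypotheses of level [k]. A minimum cut
    between [x] and [y] has requirement [k] and at most [k + 1] edges. A cut of [k] edges would be
    tight, hence thin, and force degree [k] on [x] or [y], whose requirements exceed [k]; so it has
    [k + 1] edges, which is absurd. *)
Lemma req_lower s : tight [set s] -> 0 < d [set s] ->
  (forall z, tight [set z] -> 0 < d [set z] -> d [set s] <= d [set z]) ->
  forall x y, x != y -> minn (minn (R [set x]) (R [set y])) (d [set s]) <= r x y.
Proof.
move=> ts ds smin.
pose viol (p : T * T) := (p.1 != p.2) &&
  (r p.1 p.2 < minn (minn (R [set p.1]) (R [set p.2])) (d [set s])).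
move=> x0 y0 n0; apply: contraT; rewrite -ltnNge => v0; exfalso.
have v0' : viol (x0, y0) by rewrite /viol /= n0.
case: (@arg_minnP _ (x0, y0) viol (fun p => r p.1 p.2) v0') => -[x y] /= /andP[/= nxy].
rewrite !ltn_min => /andP[/andP[Rx Ry] ks] vmin.
set k := r x y in Rx Ry ks vmin.
have k_low z : tight [set z] -> 0 < d [set z] -> k < d [set z].
  by move=> tz dz; apply: leq_trans ks (smin z tz dz).
have req_high p q : p != q -> k < R [set p] -> k < R [set q] -> k <= r p q.
  move=> npq Rp Rq; rewrite leqNgt; apply/negP => lt.
  have := vmin (p, q); rewrite /viol /= npq !ltn_min (ltn_trans lt Rp) (ltn_trans lt Rq).
  by rewrite (ltn_trans lt ks) => /(_ isT); rewrite leqNgt lt.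
have [X /andP[xX yX] eX] := mincutP E nxy.
have RX1 : k <= R X by apply: req_le_Req.
have RX2 := Req_le_cut E X.
have dX : d X <= k.+1 by rewrite -eX /k /req; lia.
have ek : odd k = false by apply: odd_req.
have RX : R X = k by have := odd_Req E X; clear -RX1 RX2 dX ek; lia.
have noA A : x \in A -> y \notin A -> k < d A.
  move=> xA yA; have RA1 : k <= R A by apply: req_le_Req.
  have RA2 := Req_le_cut E A; rewrite ltnNge; apply/negP => dA.
  have tA : tight A by rewrite /tight; clear -RA1 RA2 dA; lia.
  case: (tight_thin tA) => th.
    have [|_ dAx _] := th x xA; first by have := Req_le_cut E [set x]; clear -Rx; lia.
    by have := Req_le_cut E [set x]; clear -Rx dA dAx; lia.
  have [||_] := th y _ _; rewrite ?inE //; first by have := Req_le_cut E [set y]; clear -Ry; lia.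
  by rewrite cutC; have := Req_le_cut E [set y]; clear -Ry dA; lia.
by apply: (near_tight_absurd k_low req_high xX yX) => //; have := noA X xX yX; clear -dX; lia.
Qed.

End MinimalCounterexample.

(** * Splitting off at a tight vertex of minimum degree *)

Section Splitting.
Variables (T : finType) (E : seq (T * T)) (s : T).
Implicit Types (M : seq (T * T)) (X Y A B C K U W Z : {set T}) (x y z u v : T).

Local Notation d := (cut E).
Local Notation R := (Req E).
Local Notation r := (req E).
Local Notation e := (en E).
Local Notation D := (cut E [set s]).

Hypothesis tight_thinE : forall X, tight E X -> thin E X \/ thin E (~: X).
Hypothesis slack_nonadjE : forall x y, x != y -> slack E x -> slack E y -> e [set x] [set y] = 0.
Hypothesis tight_s : tight E [set s].
Hypothesis s_gt0 : 0 < D.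
Hypothesis s_min : forall z, tight E [set z] -> 0 < d [set z] -> D <= d [set z].
Hypothesis req_lowerE : forall x y, x != y ->
  minn (minn (R [set x]) (R [set y])) D <= r x y.

Definition high : {set T} := [set x | D <= R [set x]].
(** The sets whose requirement must survive the splitting; [s] itself is left out because its degree
    drops by two. *)
Definition sep X : bool :=
  [exists h in high :\ s, h \in X] && [exists h in high :\ s, h \notin X].
Definition nbr v : bool := (v != s) && (0 < e [set s] [set v]).

Lemma Rs : R [set s] = D. Proof. exact/eqP. Qed.

Lemma odd_D : odd D = false. Proof. by rewrite -Rs odd_Req. Qed.

Lemma high_s : s \in high. Proof. by rewrite inE Rs. Qed.

Lemma req_high x y : x \in high -> y \in high -> x != y -> D <= r x y.
Proof.
by rewrite !inE => hx hy nxy; apply: leq_trans (req_lowerE nxy); rewrite !leq_min hx hy /=.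
Qed.

Lemma high_gt0 x : x \in high -> 0 < d [set x].
Proof. by rewrite inE => h; apply: leq_trans s_gt0 (leq_trans h (Req_le_cut _ _)). Qed.

Lemma low_slack_s z : z \notin high -> slack E z.
Proof.
rewrite inE -ltnNge /slack => Rz; have := @s_min z; rewrite /tight.
by have := Req_le_cut E [set z]; move: Rz; clear; lia.
Qed.

Lemma tight_high t : tight E [set t] -> 0 < d [set t] -> t \in high.
Proof. by move=> tt dt; rewrite inE (eqP tt) s_min. Qed.

Lemma low_req z x : z \notin high -> z != x -> r z x < D.
Proof. by rewrite inE -ltnNge => h nzx; apply: leq_ltn_trans h; apply: req_le_Req1. Qed.

Lemma req_s_le x : s != x -> r s x <= D.
Proof. by move=> h; rewrite -Rs; apply: req_le_Req1. Qed.

Lemma other_high : exists2 h, h \in high & h != s.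
Proof.
have [p [q []]] : exists p q, [/\ p \in [set s], q \notin [set s] & R [set s] = r p q].
  by apply: Req_gt0; rewrite Rs.
rewrite !inE => /eqP -> nqs eR; exists q => //; rewrite inE -Rs eR.
by apply: req_le_Req1r; rewrite eq_sym.
Qed.

(** The set of [s] and [z] still separates [s] from another high vertex, so at least [D] edges leave
    it. *)
Lemma low_half z : z \notin high -> (e [set z] [set s]).*2 <= d [set z].
Proof.
move=> zl; have nsz : s != z by apply: contraNneq zl => <-; apply: high_s.
have dsz : [disjoint [set s] & [set z]] by rewrite disj_set1 // inE eq_sym.
have [h hh nhs] := other_high.
have : D <= R ([set s] :|: [set z]).
  apply: leq_trans (req_high high_s hh _) (req_le_Req _ _ _); rewrite 1?eq_sym // !inE ?eqxx //.
  by rewrite negb_or nhs; apply: contraNneq zl => <-.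
have := cutU E dsz; have := Req_le_cut E ([set s] :|: [set z]); rewrite enC; clear; lia.
Qed.

Lemma sepP X : reflect (exists h h', [/\ h \in high :\ s, h' \in high :\ s, h \in X & h' \notin X]) (sep X).
Proof.
apply: (iffP andP) => [[/exists_inP[h hh hX] /exists_inP[h' hh' h'X]]|[h [h' [hh hh' hX h'X]]]].
  by exists h, h'.
by split; apply/exists_inP; [exists h | exists h'].
Qed.

(** The requirement is at least [D] because two high vertices are separated. A pair with a low
    vertex stays below [D], and a pair with [s] reaches at most [D], so it can be traded for [h],
    [h']. *)
Lemma Req_sep X : sep X -> exists p q,
  [/\ p \in high :\ s, q \in high :\ s, p \in X, q \notin X & R X = r p q].
Proof.
case/sepP => h [h' [hh hh' hX h'X]].
have [nhs hh1] := setD1P hh; have [nh's hh1'] := setD1P hh'.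
have Dh := req_high hh1 hh1' (in_notin_neq hX h'X).
have Rh := req_le_Req E hX h'X.
have [p [q [pX qX eR]]] := ReqP E hX h'X.
have npq := in_notin_neq pX qX.
have nqp : q != p by rewrite eq_sym.
have ph : p \in high.
  apply: contraT => /low_req/(_ npq); move: Dh Rh eR; clear; lia.
have qh : q \in high.
  apply: contraT => /low_req/(_ nqp); rewrite (reqC _ nqp).
  by move: Dh Rh eR; clear; lia.
have [ps|nps] := eqVneq p s.
  exists h, h'; split=> //; have := @req_s_le q; move: npq eR; rewrite ps => npq eR /(_ npq).
  by move: Dh Rh eR; clear; lia.
have [qs|nqs] := eqVneq q s.
  exists h, h'; split=> //; have := @req_s_le p; move: nqp eR; rewrite reqC // qs => nqp eR /(_ nqp).
  by move: Dh Rh eR; clear; lia.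
by exists p, q; split=> //; rewrite !inE ?nps ?nqs; [move: ph | move: qh]; rewrite inE.
Qed.

Lemma sep_ReqU X : sep X -> R X <= R (X :|: [set s]).
Proof.
case/Req_sep => p [q [_ hq pX qX ->]]; apply: req_le_Req; rewrite !inE ?pX //.
by rewrite negb_or qX; move: hq; rewrite !inE => /andP[].
Qed.

(** The obstacles to splitting: replacing [su], [sv] by [uv] with [u] and [v] in [X] costs two edges
    of the cut. Isolated vertices are banned so that thin subsets have at most one vertex. *)
Definition dangerous X : bool :=
  [&& s \notin X, [forall x in X, 0 < d [set x]], sep X & d X <= (R X).+1].

Lemma cutUs X : s \notin X -> d (X :|: [set s]) + (e [set s] X).*2 = d X + D.
Proof. by move=> sX; rewrite enC cutU // disj_set1. Qed.

(** Adding [s] to [X] does not lower the requirement, so the cut drops by at most one; since [D] is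
    even it cannot drop at all. *)
Lemma dangerous_half X : dangerous X -> (e [set s] X).*2 <= D.
Proof.
case/and4P => sX _ sepX dX; have := cutUs sX; have := sep_ReqU sepX.
have := Req_le_cut E (X :|: [set s]); have := odd_D; move: dX; clear; lia.
Qed.

Lemma nbr_gt0 v : nbr v -> 0 < d [set v].
Proof.
case/andP=> nvs h; apply: leq_trans h _; rewrite enC; apply: en_le_cut.
by rewrite disj_set1 // inE eq_sym.
Qed.

Lemma nbr_out W : s \notin W -> e [set s] W < D -> exists2 v, nbr v & v \notin W.
Proof.
move=> sW; rewrite cut1_en (en_split E [set s] [set~ s] W).
have -> : [set~ s] :&: W = W.
  by apply/setIidPr/subsetP => x xW; rewrite !inE; apply: contraNneq sW => <-.
rewrite -[X in X < _]addn0 ltn_add2l => h.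
have dj : [disjoint [set s] & [set~ s] :\: W].
  by rewrite disjoint_sym disj_set1 // !inE eqxx andbF.
have [x [v [E' [/set1P -> ]]]] := edge_at dj h.
rewrite !inE => /andP[vW nvs] _ hen _; exists v => //.
by rewrite /nbr nvs hen /en /= !inE !eqxx.
Qed.

(** Either [Z] holds a high vertex and has at least [D >= 2] edges, or it is independent and its cut
    is at least the degree of [u], hence twice the number of edges from [u] to [s]. *)
Lemma lowcut Z u : u \in Z -> nbr u -> s \notin Z -> 2 <= d Z.
Proof.
move=> uZ nu sZ; have [/exists_inP[h hh hZ]|/exists_inPn none] := boolP [exists h in high, h \in Z].
  have := req_high hh high_s (in_notin_neq hZ sZ); have := req_le_Req E hZ sZ.
  by have := Req_le_cut E Z; have := odd_D; move: s_gt0; clear; lia.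
have low z : z \in Z -> z \notin high by move=> zZ; apply: contraL zZ => /none.
have := cutD1 E uZ; rewrite en_eq0 ?disj_D1 //; last first.
  move=> _ y /set1P -> /setD1P[nyu yZ]; apply: slack_nonadjE; rewrite 1?eq_sym //;
  by apply: low_slack_s; apply: low.
have := low_half (low u uZ); have /andP[_] := nu; rewrite enC; clear; lia.
Qed.

(** * The family of maximal dangerous sets through a neighbour of [s] *)

Section Family.
Variables (t v0 : T).
Hypotheses (nbr_t : nbr t) (nbr_v0 : nbr v0) (v0t : v0 != t).
Hypothesis all_bad : forall v, nbr v -> v != t ->
  exists X, [/\ dangerous X, t \in X & v \in X].

Definition famp : pred {set T} :=
  fun X => [&& dangerous X, t \in X & [exists v, [&& nbr v, v != t & v \in X]]].
Definition fam X : bool := maxset famp X.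

Lemma fam_famp X : fam X -> famp X. Proof. exact: maxsetp. Qed.

Lemma famD X : fam X -> dangerous X. Proof. by move/fam_famp/and3P => []. Qed.

Lemma fam_t X : fam X -> t \in X. Proof. by move/fam_famp/and3P => []. Qed.

Lemma fam_s X : fam X -> s \notin X. Proof. by move/famD/and4P => []. Qed.

Lemma fam_sep X : fam X -> sep X. Proof. by move/famD/and4P => []. Qed.

Lemma fam_cut X : fam X -> d X <= (R X).+1. Proof. by move/famD/and4P => []. Qed.

Lemma fam_gt0 X x : fam X -> x \in X -> 0 < d [set x].
Proof. by move/famD/and4P => [_ /forall_inP h _ _]; apply: h. Qed.

Lemma fam_nbr X : fam X -> exists v, [/\ nbr v, v != t & v \in X].
Proof. by move/fam_famp/and3P => [_ _ /existsP[v /and3P[]]]; exists v. Qed.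

Lemma fam_cover v : nbr v -> v != t -> exists2 X, fam X & v \in X.
Proof.
move=> nv nvt; have [X [dX tX vX]] := all_bad nv nvt.
have pX : famp X by rewrite /famp dX tX; apply/existsP; exists v; rewrite nv nvt.
by have [Y fY sXY] := maxset_exists pX; exists Y => //; apply: (subsetP sXY).
Qed.

Lemma famU X Y : fam X -> fam Y -> X != Y -> sep (X :|: Y) -> (R (X :|: Y)).+1 < d (X :|: Y).
Proof.
move=> fX fY nXY sU; rewrite ltnNge; apply: contra nXY => dU.
have dgU : dangerous (X :|: Y).
  apply/and4P; split=> //; first by rewrite inE negb_or !fam_s.
  by apply/forall_inP => x /setUP[]; [apply: fam_gt0 fX | apply: fam_gt0 fY].
have [v [nv nvt vX]] := fam_nbr fX.
have pU : famp (X :|: Y).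
  rewrite /famp dgU inE fam_t //=; apply/existsP; exists v; by rewrite nv nvt inE vX.
have /maxsetP[_ hX] := fX; have /maxsetP[_ hY] := fY.
by rewrite -{1}(hX _ pU (subsetUl _ _)) (hY _ pU (subsetUr _ _)).
Qed.

Lemma t_s_cross X Y : fam X -> fam Y -> 0 < e (X :&: Y) (~: (X :|: Y)).
Proof.
move=> fX fY; have /andP[_ h] := nbr_t; apply: leq_trans h _; rewrite enC.
by apply: en2S; rewrite sub1set !inE ?fam_t // negb_or !fam_s.
Qed.

(** Two dangerous sets have joint slack at most two. Under intersection and union, the union takes
    all of it, not being dangerous by maximality. Under differences, an edge [st] counts twice and
    takes all of it. If the union is not separating, it contains all high vertices other than [s],
    and the differences inherit the requirements. *)
Lemma fam_pair X Y : fam X -> fam Y -> X != Y ->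
  [/\ tight E (X :&: Y), sep (X :|: Y) & R X + R Y <= R (X :&: Y) + R (X :|: Y)] \/
  [/\ e (X :&: Y) (~: (X :|: Y)) = 1, tight E (X :\: Y) & tight E (Y :\: X)].
Proof.
move=> fX fY nXY; have dX := fam_cut fX; have dY := fam_cut fY.
have typeB : R X + R Y <= R (X :\: Y) + R (Y :\: X) ->
    [/\ e (X :&: Y) (~: (X :|: Y)) = 1, tight E (X :\: Y) & tight E (Y :\: X)].
  move=> h; have := cut_posimod E X Y; have := t_s_cross fX fY.
  have := Req_le_cut E (X :\: Y); have := Req_le_cut E (Y :\: X).
  move: h dX dY; rewrite /tight; clear => *; split; lia.
have [sU|nsU] := boolP (sep (X :|: Y)).
  have [h|/typeB] := Req_skew E X Y; last by right.
  left; split=> //; have := famU fX fY nXY sU; have := cut_submod E X Y.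
  have := Req_le_cut E (X :&: Y); move: h dX dY; rewrite /tight; clear; lia.
right; apply: typeB.
have cov h : h \in high :\ s -> h \in X :|: Y.
  move=> hh; apply: contraR nsU => hU; apply/sepP.
  by have /sepP[h1 [_ [hh1 _ h1X _]]] := fam_sep fX; exists h1, h; split=> //; rewrite inE h1X.
have diff X' Y' : fam X' -> (forall h, h \in high :\ s -> h \in X' :|: Y') ->
    R X' <= R (Y' :\: X').
  move=> fX' cov'; have [p [q [_ hq pX qX ->]]] := Req_sep (fam_sep fX').
  apply: req_swap_le_Req; rewrite !inE ?pX //.
  by have := cov' q hq; rewrite inE (negbTE qX) /= => ->.
rewrite addnC leq_add //; apply: diff => // h; rewrite setUC; exact: cov.
Qed.

(** The complement of the intersection is not thin: it contains [s] and a high vertex missed by the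
    union. *)
Lemma typeA_set1 X Y : fam X -> fam Y -> tight E (X :&: Y) -> sep (X :|: Y) ->
  X :&: Y = [set t] /\ tight E [set t].
Proof.
move=> fX fY tI /sepP[_ [h [_ /setD1P[nhs hh] _ hU]]].
have tXY : t \in X :&: Y by rewrite inE !fam_t.
have dt := nbr_gt0 nbr_t.
have [th|th] := tight_thinE tI.
  have [tt _ h1] := th t tXY dt; split=> //; apply/setP=> x; rewrite in_set1.
  apply/idP/eqP => [xXY|-> //]; apply: h1 => //.
  by apply: (fam_gt0 fX); move: xXY; rewrite inE => /andP[].
have sC : s \in ~: (X :&: Y) by rewrite !inE negb_and fam_s.
have [_ _ h1] := th s sC s_gt0; case/eqP: nhs; apply: h1; last exact: high_gt0.
by move: hU; rewrite !inE !negb_and negb_or => /andP[->].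
Qed.

(** The only edge from the intersection out of the union is [st], so the other neighbour of [s] in
    [X] lies outside [Y]. The complement of the difference contains [s] and [t] and is not thin. *)
Lemma typeB_set1 X Y : fam X -> fam Y -> X != Y ->
  e (X :&: Y) (~: (X :|: Y)) = 1 -> tight E (X :\: Y) ->
  exists v, [/\ nbr v, v != t & X :\: Y = [set v]].
Proof.
move=> fX fY nXY e1 tD; have dt := nbr_gt0 nbr_t.
have [v [nv nvt vX]] := fam_nbr fX.
have vY : v \notin Y.
  apply/negP => vY; have : e [set s] [set t; v] <= e (X :&: Y) (~: (X :|: Y)).
    rewrite enC; apply: en2S; rewrite ?sub1set ?subUset ?sub1set !inE ?fam_t ?vX ?vY //.
    by rewrite negb_or !fam_s.
  rewrite e1 enU; last by rewrite disj_set1 // inE.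
  by have /andP[_] := nbr_t; have /andP[_] := nv; clear; lia.
have vD : v \in X :\: Y by rewrite inE vX vY.
have [th|th] := tight_thinE tD.
  have [_ _ h1] := th v vD (nbr_gt0 nv); exists v; split=> //; apply/setP=> x; rewrite in_set1.
  apply/idP/eqP => [xD|-> //]; apply: h1 => //.
  by apply: (fam_gt0 fX); move: xD; rewrite inE => /andP[].
have sC : s \in ~: (X :\: Y) by rewrite !inE negb_and (fam_s fX) orbT.
have tC : t \in ~: (X :\: Y) by rewrite !inE fam_t.
have [_ _ h1] := th s sC s_gt0; have /andP[/eqP[]] := nbr_t; exact: h1.
Qed.

Lemma common_nbr X Y u : fam X -> fam Y -> X != Y -> nbr u -> u \in X -> u \in Y -> u = t.
Proof.
move=> fX fY nXY nu uX uY; have [[tI sU _]|[e1 _ _]] := fam_pair fX fY nXY.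
  have [eI _] := typeA_set1 fX fY tI sU; apply/set1P; by rewrite -eI inE uX.
apply/eqP; apply: contraT => nut; have : e [set s] [set t; u] <= e (X :&: Y) (~: (X :|: Y)).
  rewrite enC; apply: en2S; rewrite ?sub1set ?subUset ?sub1set !inE ?fam_t ?uX ?uY //.
  by rewrite negb_or !fam_s.
rewrite e1 enU; last by rewrite disj_set1 // inE.
by have /andP[_] := nbr_t; have /andP[_] := nu; clear; lia.
Qed.

Lemma e_t_gt0 : 0 < e [set s] [set t]. Proof. by have /andP[] := nbr_t. Qed.

(** Here [X] and [Y] are [Z] plus one vertex each. A third member [W] is confronted with both: one
    crossing of the first type makes [W] fall apart at [t], and two of the second type leave [Z]
    with a single edge. *)
Lemma no_typeB X Y : fam X -> fam Y -> X != Y ->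
  e (X :&: Y) (~: (X :|: Y)) = 1 -> tight E (X :\: Y) -> tight E (Y :\: X) -> False.
Proof.
move=> fX fY nXY e1 tXY tYX.
have nYX : Y != X by rewrite eq_sym.
have [x [nx nxt eX]] := typeB_set1 fX fY nXY e1 tXY.
have [y [ny nyt eY]] : exists v, [/\ nbr v, v != t & Y :\: X = [set v]].
  by apply: typeB_set1 => //; rewrite setIC setUC.
have sU : s \notin X :|: Y by rewrite inE negb_or !fam_s.
(* Each of [X] and [Y] receives at most half of the edges at [s], and those to [t] are shared. *)
have [v nv] : exists2 v, nbr v & v \notin X :|: Y.
  apply: nbr_out => //; have := dangerous_half (famD fX); have := dangerous_half (famD fY).
  have : 0 < e [set s] (X :&: Y).
    by apply: leq_trans e_t_gt0 (enS _ _ _); rewrite sub1set inE !fam_t.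
  rewrite (en_split E _ (X :|: Y) X) (en_split E _ Y X).
  have -> : (X :|: Y) :&: X = X by rewrite setUK.
  have -> : (X :|: Y) :\: X = Y :\: X by rewrite setDUl setDv set0U.
  rewrite [Y :&: X]setIC; clear; lia.
rewrite inE negb_or => /andP[vX vY].
have nvt : v != t by apply: contraNneq vX => ->; apply: fam_t.
have [W fW vW] := fam_cover nv nvt.
have nXW : X != W by apply: contraNneq vX => ->.
have nYW : Y != W by apply: contraNneq vY => ->.
have [xX xY] : x \in X /\ x \notin Y by have := set11 x; rewrite -eX inE => /andP[].
have [yY yX] : y \in Y /\ y \notin X by have := set11 y; rewrite -eY inE => /andP[].
have xW : x \notin W by apply: contra nxt => xW; rewrite (common_nbr fX fW nXW nx xX xW).
have yW : y \notin W by apply: contra nyt => yW; rewrite (common_nbr fY fW nYW ny yY yW).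
set Z := X :&: Y in e1.
have tZ : t \in Z by rewrite inE !fam_t.
have sZ : s \notin Z by rewrite inE negb_and fam_s.
have inX w : w \in X -> w = x \/ w \in Z.
  move=> wX; have [wY|wY] := boolP (w \in Y); [right|left]; first by rewrite inE wX.
  by apply/set1P; rewrite -eX inE wX wY.
have inY w : w \in Y -> w = y \/ w \in Z.
  move=> wY; have [wX|wX] := boolP (w \in X); [right|left]; first by rewrite inE wX.
  by apply/set1P; rewrite -eY inE wX wY.
(* The one edge from [Z] out of [X :|: Y] goes to [s], so no edge joins [t] to the rest of [W]. Each
   of these two parts has at least two edges in its cut, and the requirement of [W] is at most that
   of one part, so [W] has slack two and is not dangerous. *)
have mixed : W :&: X = [set t] \/ W :&: Y = [set t] -> False.
  move=> hW; have Wt w : w \in W -> w \in X :|: Y -> w = t.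
    move=> wW wU; have wZ : w \in Z.
      case/setUP: wU => [/inX|/inY] [ew|//]; by move: wW; rewrite ew ?(negbTE xW) ?(negbTE yW).
    by case: hW => hW; apply/set1P; rewrite -hW inE wW /=; move: wZ; rewrite inE => /andP[].
  have vC : v \in W :\ t by rewrite !inE nvt.
  have etC : e [set t] (W :\ t) = 0.
    have : e [set t] ([set s] :|: W :\ t) <= e Z (~: (X :|: Y)).
      apply: en2S; rewrite ?sub1set // subUset sub1set inE sU /=.
      apply/subsetP=> w /setD1P[nwt wW]; rewrite inE; apply: contra nwt => wU.
      by rewrite (Wt w wW wU).
    rewrite e1 enU; last by rewrite disjoint_sym disj_set1 // inE negb_and (fam_s fW) orbT.
    by rewrite (enC _ _ [set s]); have := e_t_gt0; clear; lia.
  have := cutD1 E (fam_t fW); rewrite etC.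
  have := @lowcut [set t] t; rewrite set11 => /(_ isT nbr_t).
  rewrite inE eq_sym => /(_ ltac:(by case/andP: nbr_t)).
  have sC : s \notin W :\ t by rewrite inE negb_and (fam_s fW) orbT.
  have := lowcut vC nv sC; have := fam_cut fW.
  have [p [q [_ _ pW qW ->]]] := Req_sep (fam_sep fW).
  have [ept|npt] := eqVneq p t.
    rewrite ept; have := @req_le_Req1 _ E t q; rewrite -{1}ept (in_notin_neq pW qW) => /(_ isT).
    by have := Req_le_cut E [set t]; clear; lia.
  have : r p q <= R (W :\ t).
    by apply: req_le_Req; rewrite !inE ?npt // negb_and qW orbT.
  by have := Req_le_cut E (W :\ t); clear; lia.
have [[tI sUW _]|[e1X tXW _]] := fam_pair fX fW nXW.
  by have [eI _] := typeA_set1 fX fW tI sUW; apply: mixed; left; rewrite setIC.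
have [[tI sUW _]|[e1Y tYW _]] := fam_pair fY fW nYW.
  by have [eI _] := typeA_set1 fY fW tI sUW; apply: mixed; right; rewrite setIC.
have [x' [_ _ eX']] := typeB_set1 fX fW nXW e1X tXW.
have [y' [_ _ eY']] := typeB_set1 fY fW nYW e1Y tYW.
have ZW w : w \in Z -> w \in W.
  move=> wZ; apply: contraT => wW; have [wX wY] := setIP wZ.
  have /set1P ex : x \in [set x'] by rewrite -eX' inE xX xW.
  have /set1P ew : w \in [set x'] by rewrite -eX' inE wX wW.
  by move: wY; rewrite ew -ex (negbTE xY).
have ZX : X :&: W = Z.
  apply/setP=> w; apply/setIP/idP => [[wX wW]|wZ].
    by case: (inX w wX) => // ew; move: wW; rewrite ew (negbTE xW).
  by split; [have [] := setIP wZ | apply: ZW].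
have ZY : Y :&: W = Z.
  apply/setP=> w; apply/setIP/idP => [[wY wW]|wZ].
    by case: (inY w wY) => // ew; move: wW; rewrite ew (negbTE yW).
  by split; [have [] := setIP wZ | apply: ZW].
rewrite ZX in e1X; rewrite ZY in e1Y.
have eZs : 0 < e Z [set s].
  by rewrite enC; apply: leq_trans e_t_gt0 (enS _ _ _); rewrite sub1set.
(* [Z] is the intersection of any two of [X], [Y], [W]; its single edge out of their union is the
   one to [s]. *)
have eZ0 u W1 W2 : fam W1 -> fam W2 -> u \notin W1 -> u \notin W2 -> nbr u ->
    e Z (~: (W1 :|: W2)) = 1 -> e Z [set u] = 0.
  move=> f1 f2 u1 u2 /andP[nus _] eq1.
  have : e Z ([set u] :|: [set s]) <= e Z (~: (W1 :|: W2)).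
    by apply: enS; rewrite subUset !sub1set !inE !negb_or u1 u2 !fam_s.
  rewrite eq1 enU; last by rewrite disj_set1 // inE eq_sym.
  by move: eZs; clear; lia.
have ex0 := eZ0 x Y W fY fW xY xW nx e1Y.
have ey0 := eZ0 y X W fX fW yX yW ny e1X.
have : d Z <= 1.
  rewrite cut_en (en_split _ _ _ (X :|: Y)).
  have : e Z (~: Z :&: (X :|: Y)) <= e Z ([set x] :|: [set y]).
    apply: enS; apply/subsetP=> w; rewrite !inE => /andP[].
    by rewrite -in_setI => wZ /orP[/inX|/inY] [->|wZ']; rewrite ?eqxx ?orbT //; case/negP: wZ.
  rewrite enU ?ex0 ?ey0; last by rewrite disj_set1 // inE; apply: contraNneq xY => <-.
  have : e Z (~: Z :\: (X :|: Y)) <= e Z (~: (X :|: Y)) by apply: enS; rewrite setDE subsetIr.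
  by rewrite e1; clear; lia.
by have := lowcut tZ nbr_t sZ; clear; lia.
Qed.

Lemma famA X Y : fam X -> fam Y -> X != Y ->
  [/\ X :&: Y = [set t], tight E [set t], sep (X :|: Y) & R X + R Y <= R [set t] + R (X :|: Y)].
Proof.
move=> fX fY nXY; have [[tI sU h]|[e1 t1 t2]] := fam_pair fX fY nXY; last first.
  by case: (no_typeB fX fY nXY e1 t1 t2).
by have [eI tt] := typeA_set1 fX fY tI sU; rewrite -eI; split.
Qed.

Lemma fam_disj X Y : fam X -> fam Y -> X != Y -> [disjoint X & Y :\ t].
Proof.
move=> fX fY nXY; have [eI _ _ _] := famA fX fY nXY.
rewrite -setI_eq0; apply/eqP/setP=> x; rewrite !inE; apply/negP => /and3P[xX nxt xY].
by have := in_set1 x t; rewrite -eI inE xX xY (negbTE nxt).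
Qed.

Lemma fam_small X : fam X -> e [set s] X < D.
Proof. by move/famD/dangerous_half; move: s_gt0; clear; lia. Qed.

Lemma fam_another X : fam X -> exists2 Y, fam Y & X != Y.
Proof.
move=> fX; have [v nv vX] := nbr_out (fam_s fX) (fam_small fX).
have nvt : v != t by apply: contraNneq vX => ->; apply: fam_t.
by have [Y fY vY] := fam_cover nv nvt; exists Y => //; apply: contraNneq vX => ->.
Qed.

Lemma tight_t : tight E [set t].
Proof.
have [X fX _] := fam_cover nbr_v0 v0t; have [Y fY nXY] := fam_another fX.
by have [] := famA fX fY nXY.
Qed.

Lemma exists_q : exists q, [/\ q \in high :\ s, q != t & R [set t] = r t q].
Proof.
have [X fX _] := fam_cover nbr_v0 v0t; have /sepP[_ [h [_ hh _ hX]]] := fam_sep fX.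
have nht : h != t by apply: contraNneq hX => ->; apply: fam_t.
have st : sep [set t].
  apply/sepP; exists t, h; split; rewrite ?set11 ?in_set1 // inE.
  by rewrite in_set1 (tight_high tight_t (nbr_gt0 nbr_t)); case/andP: nbr_t => ->.
have [p [q [_ hq /set1P -> qt eR]]] := Req_sep st; exists q; split=> //.
by move: qt; rewrite inE.
Qed.

Local Notation alpha X := (e [set t] (X :\ t)).
(** In a bad set the requirement is attained only from [t], and equals that of [t]. *)
Definition good X := R X <= R (X :\ t).

Lemma fam_alpha X : fam X -> d X + (alpha X).*2 = d [set t] + d (X :\ t).
Proof. by move=> fX; apply: cutD1; apply: fam_t. Qed.

Lemma good_alpha X : fam X -> good X -> R [set t] <= (alpha X).*2.
Proof.
move=> fX gX; have := fam_alpha fX; have := fam_cut fX; have := Req_le_cut E (X :\ t).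
have := eqP tight_t; have := odd_Req E [set t]; move: gX; rewrite /good; clear; lia.
Qed.

Lemma alpha2 X Y : fam X -> fam Y -> X != Y -> alpha X + alpha Y < d [set t].
Proof.
move=> fX fY nXY; rewrite cut1_en.
have dXY : [disjoint X :\ t & Y :\ t] by apply: disjointWl (fam_disj fX fY nXY); apply: subsetDl.
have : e [set t] ([set s] :|: (X :\ t :|: Y :\ t)) <= e [set t] [set~ t].
  apply: enS; rewrite !subUset sub1set !inE eq_sym; case/andP: nbr_t => -> _ /=.
  by apply/andP; split; apply/subsetP=> x; rewrite !inE => /andP[].
rewrite enU; last by rewrite disjoint_sym disj_set1 // !inE (negbTE (fam_s fX)) (negbTE (fam_s fY)) !andbF.
rewrite enU // (enC _ _ [set s]); have := e_t_gt0; clear; lia.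
Qed.

(** A good set takes at least half of the edges at [t]; two of them, disjoint outside [t], would
    leave none for [s]. *)
Lemma one_good X Y : fam X -> fam Y -> good X -> good Y -> X = Y.
Proof.
move=> fX fY gX gY; apply/eqP; apply: contraT => nXY.
have := alpha2 fX fY nXY; have := good_alpha fX gX; have := good_alpha fY gY.
by have := eqP tight_t; clear; lia.
Qed.

(** A pair attaining [R X] must start at [t], or removing [t] would not lower the requirement. If
    [q] were in [X], the ultrametric inequality would let [q] replace [t]. *)
Lemma bad_facts q X : q != t -> R [set t] = r t q -> fam X -> ~~ good X ->
  [/\ q \notin X, R X = R [set t] & d (X :\ t) <= (alpha X).*2.+1].
Proof.
move=> nqt eq fX; rewrite /good -ltnNge => bX.
have [p [z [_ _ pX zX eR]]] := Req_sep (fam_sep fX).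
have zXt : z \notin X :\ t by rewrite inE negb_and zX orbT.
have ept : p = t.
  apply/eqP; apply: contraT => npt; move: bX.
  have : r p z <= R (X :\ t) by apply: req_le_Req; rewrite // !inE npt.
  by rewrite eR; clear; lia.
rewrite {p}ept in pX eR.
have le1 := req_le_Req1 E (in_notin_neq pX zX).
have qX : q \notin X.
  apply/negP => qX; move: bX.
  have : r q z <= R (X :\ t) by apply: req_le_Req; rewrite // !inE nqt.
  have := req_ultra E nqt (in_notin_neq pX zX) (in_notin_neq qX zX).
  rewrite (reqC _ nqt) -eq -eR; move: le1 eR; rewrite /minn; case: ifP; clear; lia.
have eRt : R X = R [set t].
  have : r t q <= R X by apply: req_le_Req.
  by move: le1 eR eq; clear; lia.
split=> //; have := fam_alpha fX; have := fam_cut fX; have := eqP tight_t.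
by move: eRt; clear; lia.
Qed.

(* W0 absorbs the bad members of the family: each of them raises the cut by at
   most one and the number of edges from s by at least one. *)
Lemma absorb q W0 : q != t -> R [set t] = r t q -> t \in W0 -> s \notin W0 ->
  (forall X, fam X -> ~~ good X -> [disjoint W0 & X :\ t]) ->
  (forall X, fam X -> good X -> X \subset W0) ->
  exists U : {set T}, [/\ W0 \subset U, s \notin U, forall X, fam X -> X \subset U,
    forall u, u \in U -> u \in W0 \/ exists X, [/\ fam X, ~~ good X & u \in X :\ t] &
    d (U :|: [set s]) + e [set s] W0 <= d W0].
Proof.
move=> nqt eq tW sW dW gW.
pose bads := [set X | fam X && ~~ good X].
pose U_ xs := W0 :|: \bigcup_(X <- xs) (X :\ t).
have main xs : uniq xs -> {subset xs <= bads} ->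
    d (U_ xs) + e [set s] W0 <= d W0 + e [set s] (U_ xs).
  elim: xs => [|X xs IH] /=; first by rewrite /U_ big_nil setU0.
  case/andP=> Xxs uxs sxs.
  have {}IH := IH uxs (fun Y hY => sxs Y (mem_behead (s := X :: xs) hY)).
  have := sxs X (mem_head _ _); rewrite inE => /andP[fX bX].
  have -> : U_ (X :: xs) = U_ xs :|: X :\ t by rewrite /U_ big_cons setUCA setUC.
  have dU : [disjoint U_ xs & X :\ t].
    rewrite -setI_eq0 setIUl setU_eq0 setI_eq0 dW //=.
    rewrite big_distrl /=; apply/eqP; rewrite big_seq big1 // => Y Yxs.
    have := sxs Y (mem_behead (s := X :: xs) Yxs); rewrite inE => /andP[fY _].
    apply/eqP; rewrite setI_eq0; apply: disjointWl (fam_disj fY fX _); rewrite ?subsetDl //.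
    by apply: contraNneq Xxs => <-.
  have := cutU E dU; rewrite enU //.
  have : alpha X <= e (U_ xs) (X :\ t) by apply: en2S; rewrite // sub1set inE tW.
  have [v [nv nvt vX]] := fam_nbr fX.
  have : 0 < e [set s] (X :\ t).
    by case/andP: nv => _ h; apply: leq_trans h (enS _ _ _); rewrite sub1set !inE nvt.
  have [_ _] := bad_facts nqt eq fX bX; move: IH; clear; lia.
exists (U_ (enum bads)).
have inU X : fam X -> X \subset U_ (enum bads).
  move=> fX; have [gX|bX] := boolP (good X); first by apply: subset_trans (gW X fX gX) (subsetUl _ _).
  apply/subsetP=> x xX; rewrite inE; have [->|nxt] := eqVneq x t; first by rewrite tW.
  apply/orP; right; rewrite big_enum; apply/bigcupP; exists X; first by rewrite inE fX.
  by rewrite !inE nxt.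
have sU : s \notin U_ (enum bads).
  rewrite inE (negbTE sW) /= big_enum; apply/bigcupP => -[X].
  by rewrite inE => /andP[fX _]; rewrite !inE (negbTE (fam_s fX)) andbF.
have eU : D <= e [set s] (U_ (enum bads)).
  rewrite leqNgt; apply/negP => /(nbr_out sU)[v nv]; apply/negP; rewrite negbK.
  have [->|nvt] := eqVneq v t; first by rewrite inE tW.
  by have [X fX vX] := fam_cover nv nvt; apply: (subsetP (inU X fX)).
split=> //; first exact: subsetUl.
  move=> u /setUP[->|]; first by left.
  rewrite big_enum => /bigcupP[X]; rewrite inE => /andP[fX bX] uX.
  by right; exists X.
have := main (enum bads) (enum_uniq _); have := cutUs sU.
have sb : {subset enum bads <= bads} by move=> X; rewrite mem_enum.
move=> h1 /(_ sb); move: h1 eU; clear; lia.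
Qed.

(** Absorbing all bad sets and then adding [s] makes a cut too small: for the requirement of [t] if
    there is no good set, and otherwise only small enough to send large demands from the good set
    [X1] into two bad ones, which overfill its cut. *)
Lemma family_absurd : False.
Proof.
have [q [qh nqt eq]] := exists_q.
have nqs : q != s by case/setD1P: qh.
have nts : t != s by case/andP: nbr_t.
have [/existsP[X1 /andP[f1 g1]]|/existsPn none] := boolP [exists X, fam X && good X]; last first.
  (* The set [U] together with [s] separates [t] from [q], yet its cut is smaller than [d [set t] =
     r t q]. *)
  have [|||X fX gX|U [WU sU inU Uin]] := @absorb q [set t] nqt eq.
  - exact: set11.
  - by rewrite inE eq_sym.
  - by move=> X _ _; apply: disj_D1.
  - by have := none X; rewrite fX gX.
  have qU : q \notin U :|: [set s].
    rewrite !inE negb_or nqs andbT; apply/negP => /Uin[/set1P/eqP|[X [fX bX /setD1P[_ qX]]]].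
      by rewrite (negbTE nqt).
    by have [] := bad_facts nqt eq fX bX; rewrite qX.
  have tU : t \in U :|: [set s] by rewrite inE (subsetP WU) ?set11.
  have := req_le_Req E tU qU; have := Req_le_cut E (U :|: [set s]); have := e_t_gt0.
  by have := eqP tight_t; move: eq; clear; lia.
have bad_neq X : ~~ good X -> X1 != X by apply: contraNneq => <-.
have [||X fX bX|X fX gX|U [WU sU inU Uin dU]] := @absorb q X1 nqt eq.
- exact: fam_t.
- exact: fam_s.
- by apply: fam_disj => //; apply: bad_neq.
- by rewrite (one_good fX f1 gX g1).
have e2 : 2 <= e [set s] X1.
  have [v [nv nvt vX]] := fam_nbr f1.
  have : e [set s] ([set t] :|: [set v]) <= e [set s] X1.
    by apply: enS; rewrite subUset !sub1set fam_t.
  rewrite enU; last by rewrite disj_set1 // inE.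
  by case/andP: nv => _; have := e_t_gt0; clear; lia.
have RU : R (U :|: [set s]) < R X1.
  by have := Req_le_cut E (U :|: [set s]); have := fam_cut f1; move: dU e2; clear; lia.
(* By [famA] the union of [X1] and [X2] requires at least [R X1]. A pair attaining this is not
   separated by [U] with [s], so its outer end [z] lies in another bad set [X3], whose part outside
   [t] must then have a large cut. *)
have step X2 : fam X2 -> ~~ good X2 ->
    exists X3, [/\ fam X3, ~~ good X3, X3 != X2 & R X1 <= (alpha X3).*2].
  move=> f2 b2; have n12 := bad_neq X2 b2; have [_ _ s12 R12] := famA f1 f2 n12.
  have [_ eR2 _] := bad_facts nqt eq f2 b2.
  have [p [z [_ zh pX zX eR]]] := Req_sep s12.
  have le1 : R X1 <= r p z by move: R12 eR2 eR; clear; lia.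
  have pU : p \in U :|: [set s].
    by rewrite inE; case/setUP: pX => h; rewrite ?(subsetP (inU _ f1) _ h) ?(subsetP (inU _ f2) _ h).
  have zU : z \in U.
    apply: contraT => zU; have : r p z <= R (U :|: [set s]).
      by apply: req_le_Req; rewrite // !inE negb_or zU; case/setD1P: zh => ->.
    by move: RU le1; clear; lia.
  move: zX; rewrite inE negb_or => /andP[z1 z2].
  have [h|[X3 [f3 b3 zX3]]] := Uin z zU; first by rewrite h in z1.
  have n32 : X3 != X2 by apply: contraNneq z2 => <-; move: zX3; rewrite inE => /andP[].
  exists X3; split=> //.
  have pX3 : p \notin X3 :\ t.
    case/setUP: pX => h; first by rewrite (disjointFr (fam_disj f1 f3 (bad_neq _ b3)) h).
    by rewrite (disjointFr (fam_disj f2 f3 _) h) // eq_sym.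
  have := req_swap_le_Req E pX3 zX3; have [_ _] := bad_facts nqt eq f3 b3.
  have := Req_le_cut E (X3 :\ t); have := odd_Req E X1; move: le1; clear; lia.
have [X2 f2 n12] := fam_another f1.
have b2 : ~~ good X2 by apply: contra n12 => g2; rewrite (one_good f1 f2).
have [X3 [f3 b3 _ a3]] := step X2 f2 b2.
have [X4 [f4 b4 n43 a4]] := step X3 f3 b3.
have d13 := fam_disj f1 f3 (bad_neq _ b3); have d14 := fam_disj f1 f4 (bad_neq _ b4).
have d34 : [disjoint X3 :\ t & X4 :\ t].
  by apply: disjointWl (fam_disj f3 f4 _); rewrite ?subsetDl // eq_sym.
(* At least two edges of the cut of [X1] go to [s], and at least [R X1] go to [X3] and [X4]
   together, against [d X1 <= R X1 + 1]. *)
have : e X1 ([set s] :|: (X3 :\ t :|: X4 :\ t)) <= d X1.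
  rewrite cut_en; apply: enS; rewrite !subUset sub1set inE fam_s //=.
  by rewrite -!disjoints_subset ![[disjoint _ & X1]]disjoint_sym d13.
rewrite enU; last by rewrite disjoint_sym disj_set1 // !inE (negbTE (fam_s f3)) (negbTE (fam_s f4)) !andbF.
rewrite enU // (enC _ _ [set s]).
have le3 : alpha X3 <= e X1 (X3 :\ t) by apply: en2S; rewrite // sub1set fam_t.
have le4 : alpha X4 <= e X1 (X4 :\ t) by apply: en2S; rewrite // sub1set fam_t.
have := fam_cut f1; move: e2 a3 a4 le3 le4; clear; lia.
Qed.

End Family.

(** If [t] is the only neighbour of [s], it receives all [D] edges, and two of them are split off.
    Otherwise some other neighbour is compatible with [t], or the family of dangerous sets gives a
    contradiction. *)
Lemma exists_split : exists u v, [/\ nbr u, nbr v, (u != v) || (2 <= e [set s] [set u]) &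
  forall X, s \notin X -> u \in X -> v \in X -> sep X -> R X + 2 <= d X].
Proof.
have [t nt _] : exists2 v, nbr v & v \notin set0.
  by apply: nbr_out; rewrite ?inE // en0.
have [/existsP[v0 /andP[nv0 v0t]]|/existsPn single] := boolP [exists v, nbr v && (v != t)]; last first.
  have eD : D <= e [set s] [set t].
    rewrite leqNgt; apply/negP => /nbr_out[|v nv]; first by rewrite inE eq_sym; case/andP: nt.
    by rewrite inE => nvt; have := single v; rewrite nv nvt.
  exists t, t; split=> //.
    by rewrite eqxx /=; have := odd_D; move: eD s_gt0; clear; lia.
  move=> X sX tX _ sepX; have := cutUs sX; have := sep_ReqU sepX.
  have := Req_le_cut E (X :|: [set s]).
  have : e [set s] [set t] <= e [set s] X by apply: enS; rewrite sub1set.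
  by have := odd_D; move: eD s_gt0; clear; lia.
pose bad v X := [&& s \notin X, t \in X, v \in X, sep X & d X < R X + 2].
have [/forallP all_bad|] := boolP [forall v, (nbr v && (v != t)) ==> [exists X, bad v X]]; last first.
  rewrite negb_forall => /existsP[v]; rewrite negb_imply => /andP[/andP[nv nvt] /existsPn h].
  exists t, v; split=> // [|X sX tX vX sepX]; first by rewrite eq_sym nvt.
  by have := h X; rewrite /bad sX tX vX sepX /= -leqNgt.
exfalso; apply: (@family_absurd t v0) => // v nv nvt.
have := all_bad v; rewrite nv nvt => /existsP[X /and5P[sX tX vX sepX dX]].
(* Dropping the isolated vertices keeps the cut and the high vertices of [X] and makes it
   dangerous. *)
pose N := [set x | 0 < d [set x]].
have cN : d (X :&: N) = d X.
  have := cutU E (A := X :&: N) (B := X :\: N); rewrite setID => h.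
  have d0 B : B \subset ~: N -> d B = 0.
    move=> /subsetP sB; apply/eqP; apply: contraT; rewrite -lt0n cut_en.
    have dB : [disjoint B & ~: B] by rewrite disjoints_subset setCK.
    case/(edge_at dB) => x [y [E' [xB yB cE _ _]]]; have := sB x xB.
    rewrite !inE cE /crosses /= !inE eqxx; move: yB; rewrite inE.
    by case: eqP => [->|]; rewrite ?xB.
  have z0 := d0 _ (subsetDr X N).
  have dj : [disjoint X :&: N & X :\: N].
    by rewrite -setI_eq0 setDE setIACA setICr setI0.
  have := en_le_cut E (A := X :\: N) (B := X :&: N); rewrite disjoint_sym dj => /(_ isT).
  by have := h dj; rewrite z0 enC; clear; lia.
have sub h : h \in high :\ s -> (h \in X :&: N) = (h \in X).
  by case/setD1P => _ /high_gt0 dh; rewrite !inE dh andbT.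
exists (X :&: N); split; rewrite ?inE ?tX ?vX ?nbr_gt0 //.
apply/and4P; split.
- by rewrite inE negb_and sX.
- by apply/forall_inP => x; rewrite !inE => /andP[].
- case/sepP: sepX => h [h' [hh hh' hX h'X]]; apply/sepP; exists h, h'; split=> //; by rewrite sub.
- have [p [q [ph qh pX qX eR]]] := Req_sep sepX.
  have : r p q <= R (X :&: N) by apply: req_le_Req; rewrite sub.
  by rewrite cN; move: dX eR; clear; lia.
Qed.

End Splitting.

(** The pairing of the split graph serves for [E]: parities agree, cuts do not grow, and separating
    sets keep their requirement. Any other set has, on one side, only low vertices apart from [s],
    where independence gives the bound. *)
Lemma split_pairable (T : finType) (E : seq (T * T)) (s : T) :
  (forall E' : seq (T * T), nonloops E' < nonloops E -> pairable E') ->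
  ~ pairable E -> tight E [set s] -> 0 < cut E [set s] ->
  (forall z, tight E [set z] -> 0 < cut E [set z] -> cut E [set s] <= cut E [set z]) ->
  pairable E.
Proof.
move=> IH npE ts ds smin.
have ththin := tight_thin IH npE; have nonadj := slack_nonadj IH npE.
have rlow := req_lower IH npE ts ds smin.
have [u [v [nu nv uv hsplit]]] := exists_split ththin nonadj ts ds smin rlow.
have [nus eu] := andP nu; have [nvs ev] := andP nv.
have dj w : w != s -> [disjoint [set s] & [set w]].
  by move=> h; rewrite disj_set1 // inE.
have [_ [_ [E1 [/set1P -> /set1P -> c1 en1 n1]]]] := edge_at (dj _ nus) eu.
have ev1 : 0 < en E1 [set s] [set v].
  move: ev uv; rewrite !en1 /en /= !inE !eqxx (negbTE nus) /=.
  by case: (eqVneq u v) => [<-|_]; rewrite ?eqxx ?(negbTE nvs) /=; clear; lia.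
have [_ [_ [E2 [/set1P -> /set1P -> c2 _ n2]]]] := edge_at (dj _ nvs) ev1.
pose E' := (u, v) :: E2.
have cE X : cut E X = crosses X (s, u) + (crosses X (s, v) + cut E2 X) by rewrite c1 c2.
have cE' X : cut E' X = crosses X (u, v) + cut E2 X by [].
have lt : nonloops E' < nonloops E.
  by rewrite n1 n2 /E' /nonloops /=; case: (u != v); clear; lia.
have [M [oM rM] degM] := pairing_deg1 (IH _ lt).
have oE X : odd (cut M X) = odd (cut E X).
  rewrite oM cE cE' /crosses /=.
  by case: (s \in X); case: (u \in X); case: (v \in X); clear; lia.
have leE X : cut E' X <= cut E X.
  rewrite cE cE' /crosses /=.
  by case: (s \in X); case: (u \in X); case: (v \in X); clear; lia.
have sepC X : sep E s X -> sep E s (~: X).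
  by case/sepP => h [h' [hh hh' hX h'X]]; apply/sepP; exists h', h; split; rewrite // inE ?negbK.
have sepE' X : sep E s X -> Req E X <= cut E' X.
  wlog sX : X / s \notin X => [hw|sepX].
    have [sX|] := boolP (s \in X); last exact: hw.
    by move/sepC/hw; rewrite inE negbK ReqC cutC; apply.
  have := hsplit X sX; rewrite cE cE' /crosses /= (negbTE sX).
  have := Req_le_cut E X; rewrite cE /crosses /= (negbTE sX).
  case: (u \in X); case: (v \in X) => /= h1 h2; try by move: h1; clear; lia.
  by move: (h2 isT isT sepX); clear; lia.
have sepR X : sep E s X -> Req E X <= Req E' X.
  move=> sepX; have [p [q [hp hq pX qX ->]]] := Req_sep ts rlow sepX.
  apply: leq_trans (req_le_Req _ pX qX); apply: le_req => [||Y pY qY].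
  - exact: in_notin_neq pX qX.
  - by rewrite odd_req.
  - apply: leq_trans (sepE' Y _); first exact: req_le_Req.
    by apply/sepP; exists p, q.
exists M; split=> // X.
have [sepX|] := boolP (sep E s X).
  by have := rM X; have := sepR X sepX; have := leE X; clear; lia.
have low z : z \notin high E s -> slack E z by apply: low_slack_s.
have base (Y : {set T}) : ~~ [exists h in high E s :\ s, h \in Y] -> cut M Y + Req E Y <= cut E Y.
  move=> /exists_inPn none.
  have lowY z : z \in Y -> z != s -> z \notin high E s.
    by move=> zY nzs; apply: contraL zY => zh; apply: none; rewrite in_setD1 nzs.
  have [sY|sY] := boolP (s \in Y); last first.
    apply: (slack_bound IH npE) => // z zY; apply/low/lowY => //.
    by apply: contraNneq sY => <-.
  have RY : Req E Y <= cut E [set s].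
    have [->//|/Req_gt0[p [q [pY qY ->]]]] := posnP (Req E Y).
    have npq := in_notin_neq pY qY.
    have [eps|nps] := eqVneq p s; first by move: npq; rewrite eps; apply: req_s_le.
    exact: ltnW (low_req (lowY p pY nps) npq).
  have := @cut_extend _ E M [set s] (Y :\ s); rewrite setD1K //.
  (* The degree of [s] is even, so [M] misses it; thus [cut_extend] can start from [s], whose cut
     [D] already covers [Req E Y]. *)
  have s0 : cut M [set s] = 0.
    by have := degM s; have := oE [set s]; rewrite (odd_D ts); clear; lia.
  have h1 : {in Y :\ s, forall z, slack E z /\ z \notin high E s}.
    by move=> z /setD1P[nzs zY]; have := lowY z zY nzs; split=> //; apply: low.
  rewrite s0 addn0 => h; apply: leq_trans (h _ _ _ _ _); rewrite ?leq_add2l ?disj_D1 //.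
  - by move=> z z' /h1[sz _] /h1[sz' _] nz; apply: nonadj.
  - by move=> z /h1[_ hz]; apply: low_half.
rewrite /sep negb_and => /orP[|h]; first exact: base.
rewrite -(cutC M) -ReqC -(cutC E); apply: base.
apply: contra h => /exists_inP[h hh]; rewrite inE => hX.
by apply/exists_inP; exists h.
Qed.

(* Nash-Williams' odd vertex pairing theorem. *)
Theorem odd_vertex_pairing (T : finType) (E : seq (T * T)) : pairable E.
Proof.
have [n] := ubnP (nonloops E); elim: n E => // n IHn E; rewrite ltnS => le_n.
have IH (E' : seq (T * T)) : nonloops E' < nonloops E -> pairable E'.
  by move=> lt; apply: IHn; apply: leq_trans lt le_n.
apply: NNPP => npE; have [s0 hs0] := exists_tight IH npE.
case: (@arg_minnP _ s0 (fun z => tight E [set z] && (0 < cut E [set z]))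
  (fun z => cut E [set z]) hs0) => s /andP[ts ds] smin.
apply: (npE); apply: (split_pairable IH npE ts ds) => z tz dz.
by apply: smin; rewrite tz.
Qed.

(** * From pairings to orientations *)

Section Orientation.
Variable T : finType.
Implicit Types (E O M : seq (T * T)) (X : {set T}) (a : T * T).

Definition ends a : {set T} := [set a.1; a.2].
Definition outs O X : nat := count (fun a => (a.1 \in X) && (a.2 \notin X)) O.
Arguments outs : simpl never.

Lemma crossesE X a : crosses X a = ~~ [disjoint ends a & X] && ~~ (ends a \subset X).
Proof.
rewrite -setI_eq0 /ends setIUl setU_eq0 subUset !sub1set !setI_eq0 !disjoints1 /crosses.
by case: (_ \in X); case: (_ \in X).
Qed.

Lemma crosses_ends X a b : ends a = ends b -> crosses X a = crosses X b.
Proof. by rewrite !crossesE => ->. Qed.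

Lemma cut_ends O E X : perm_eq (map ends O) (map ends E) -> cut O X = cut E X.
Proof.
pose g (S : {set T}) := ~~ [disjoint S & X] && ~~ (S \subset X).
move=> /permP h; have hc : crosses X =1 preim ends g by move=> a; apply: crossesE.
by rewrite /cut !(eq_count hc) -!count_map h.
Qed.

Lemma sum_count_fst O X : \sum_(x in X) count (fun a => a.1 == x) O = count (fun a => a.1 \in X) O.
Proof.
elim: O => [|a O IH] /=; first by rewrite big1.
rewrite big_split /= IH; congr (_ + _).
have [aX|aX] := boolP (a.1 \in X).
  by rewrite (bigD1 a.1) //= eqxx big1 // => x /andP[_ nx]; rewrite eq_sym (negbTE nx).
by rewrite big1 // => x xX; case: eqP => // h; rewrite h xX in aX.
Qed.

Lemma sum_count_snd O X : \sum_(x in X) count (fun a => a.2 == x) O = count (fun a => a.2 \in X) O.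
Proof.
elim: O => [|a O IH] /=; first by rewrite big1.
rewrite big_split /= IH; congr (_ + _).
have [aX|aX] := boolP (a.2 \in X).
  by rewrite (bigD1 a.2) //= eqxx big1 // => x /andP[_ nx]; rewrite eq_sym (negbTE nx).
by rewrite big1 // => x xX; case: eqP => // h; rewrite h xX in aX.
Qed.

Lemma outs_balance O X : outs O X + \sum_(x in X) count (fun a => a.2 == x) O =
  outs O (~: X) + \sum_(x in X) count (fun a => a.1 == x) O.
Proof.
rewrite sum_count_fst sum_count_snd /outs; elim: O => //= a O; rewrite !inE.
by case: (a.1 \in X); case: (a.2 \in X) => /=; clear; lia.
Qed.

Lemma outs_cut O X : outs O X + outs O (~: X) = cut O X.
Proof.
rewrite /outs /cut; elim: O => //= a O; rewrite !inE /crosses.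
by case: (a.1 \in X); case: (a.2 \in X) => /=; clear; lia.
Qed.

(* Nash-Williams' strong orientation theorem. *)
Theorem well_balanced_orientation E : exists O,
  map ends O = map ends E /\ forall X, Req E X <= (outs O X).*2.
Proof.
have [M [oM rM]] := odd_vertex_pairing E.
have even x : ~~ odd (cut (E ++ M) [set x]) by rewrite cut_cat oddD oM addbb.
have [O [hO bO]] := eulerian_orientation even.
have [E0|Epos] := posnP (size (E ++ M)).
  exists [::]; have -> : E = [::] by move: E0; case: (E).
  by split=> // X; apply: leq_trans (Req_le_cut _ _) _.
have [a0 _] : exists a, a \in E ++ M by move: Epos; case: (E ++ M) => // a l _; exists a; rewrite mem_head.
(* The arcs are listed in the order of [E ++ M], so that the first [size E] of them orient [E] edge
   by edge. *)
have /(perm_iotaP (ends a0))[Is pIs eIs] : perm_eq (map ends (E ++ M)) (map ends O).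
  by rewrite perm_sym.
rewrite size_map in pIs.
pose O' := map (nth a0 O) Is.
have mO' : map ends O' = map ends (E ++ M).
  rewrite eIs -map_comp; apply/eq_in_map => i; rewrite (perm_mem pIs) mem_iota /= => ltO.
  by rewrite (nth_map a0).
have pO' : perm_eq O O' by rewrite perm_sym; apply/(perm_iotaP a0); exists Is.
exists (take (size E) O'); split.
  by rewrite map_take mO' map_cat take_size_cat // size_map.
move=> X; have bal : outs O X = outs O (~: X).
  have := outs_balance O X.
  have -> : \sum_(x in X) count (fun a => a.1 == x) O = \sum_(x in X) count (fun a => a.2 == x) O.
    by apply: eq_bigr => x _.
  clear; lia.
(* Half of the edges of [E ++ M] crossing [X] leave it, and at most [cut M X] of these belong to
   [M]. *)
have := outs_cut O X; rewrite -bal (cut_ends (E := E ++ M)) // cut_cat.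
have -> : outs O X = outs (take (size E) O') X + outs (drop (size E) O') X.
  by rewrite /outs -count_cat cat_take_drop; have /permP -> := pO'.
have mO2 : map ends (drop (size E) O') = map ends M.
  by rewrite map_drop mO' map_cat drop_size_cat // size_map.
have := outs_cut (drop (size E) O') X; rewrite (cut_ends (E := M)) ?mO2 //.
have := rM X; clear; lia.
Qed.

End Orientation.

Arguments outs : simpl never.

(** * Menger's theorem for arc-disjoint paths *)

Section Menger.
Variable T : finType.
Implicit Types (O : seq (T * T)) (D : {set T * T}) (X Y A B : {set T}) (x y u v : T).

Definition btw O A B : nat := count (fun a => (a.1 \in A) && (a.2 \in B)) O.

Lemma btwS O A A' B B' : A \subset A' -> B \subset B' -> btw O A B <= btw O A' B'.
Proof.
move=> /subsetP sA /subsetP sB; apply: sub_count => a /andP[ha hb] /=.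
by rewrite sA // sB.
Qed.

Lemma outs_submod O X Y : outs O (X :&: Y) + outs O (X :|: Y) <= outs O X + outs O Y.
Proof.
rewrite /outs; elim: O => //= a O; rewrite !inE.
by case: (a.1 \in X); case: (a.2 \in X); case: (a.1 \in Y); case: (a.2 \in Y) => /=; clear; lia.
Qed.

Lemma outs_add1 O X x : x \notin X ->
  outs O (x |: X) + btw O X [set x] = outs O X + btw O [set x] (~: (x |: X)).
Proof.
move=> xX; rewrite /outs /btw; elim: O => //= -[y z] O /=; rewrite !inE.
case: (eqVneq y x) => [->|_]; case: (eqVneq z x) => [->|_]; rewrite ?(negbTE xX) /=;
by case: (y \in X); case: (z \in X) => /=; clear; lia.
Qed.

Lemma outs_perm O O' X : perm_eq O O' -> outs O X = outs O' X.
Proof. by move/permP; apply. Qed.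

Lemma outs_setD D D' X : D' \subset D ->
  outs (enum D) X = outs (enum (D :\: D')) X + outs (enum D') X.
Proof.
move=> sD; rewrite /outs -count_cat; apply/permP; apply: uniq_perm.
- exact: enum_uniq.
- rewrite cat_uniq !enum_uniq andbT; apply/hasPn => a.
  by rewrite /= !mem_enum inE => ->.
- move=> a; rewrite mem_cat !mem_enum inE.
  by case: (boolP (a \in D')) => //= aD'; rewrite ?orbF // (subsetP sD).
Qed.

Lemma path_outs X u p :
  outs (path_arcs u p) X + (last u p \in X) = outs (path_arcs u p) (~: X) + (u \in X).
Proof.
elim: p u => [|y p IH] u //=; have := IH y; rewrite /path_arcs /= /outs /= !inE.
by case: (u \in X); case: (y \in X); case: (last y p \in X) => /=; clear; lia.
Qed.

Lemma mem_path_arcs (r : rel T) u p : path r u p -> {in path_arcs u p, forall a, r a.1 a.2}.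
Proof.
elim: p u => [|y p IH] u //= /andP[ruy rp] a; rewrite /path_arcs /= inE.
by case/orP => [/eqP ->//|]; apply: IH.
Qed.

Lemma uniq_path_arcs u p : uniq (u :: p) -> uniq (path_arcs u p).
Proof.
case/andP=> _ h; apply: (@map_uniq _ _ snd).
by rewrite -/(unzip2 _) unzip2_zip // size_belast.
Qed.

Lemma outs_net O u X : u \in X -> count (fun a => a.2 == u) O = 0 ->
  (forall x, x \in X -> x != u ->
     count (fun a => a.2 == x) O = count (fun a => a.1 == x) O) ->
  outs O (~: X) + count (fun a => a.1 == u) O = outs O X.
Proof.
move=> uX u0 bal; have := outs_balance O X.
rewrite (bigD1 u uX) [in RHS](bigD1 u uX) /= u0.
have -> : \sum_(x in X | x != u) count (fun a => a.2 == x) O =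
          \sum_(x in X | x != u) count (fun a => a.1 == x) O.
  by apply: eq_bigr => x /andP[]; apply: bal.
by rewrite add0n addnA => /addIn ->.
Qed.

(** * Minimal arc sets with at least [k] arcs out of every [u]-[v] cut *)

Section Minimal.
Variables (k : nat) (u v : T) (D : {set T * T}).
Definition cut_large D := [forall X : {set T}, (u \in X) && (v \notin X) ==> (k <= outs (enum D) X)].
Hypothesis minD : minset cut_large D.

Local Notation out := (outs (enum D)).
Definition tight_out X := [&& u \in X, v \notin X & out X == k].

Lemma min_large X : u \in X -> v \notin X -> k <= out X.
Proof. by move=> uX vX; have /forallP/(_ X) := minsetp minD; rewrite uX vX. Qed.

Lemma arc_tight a : a \in D -> exists X, [/\ tight_out X, a.1 \in X & a.2 \notin X].
Proof.
move=> aD; have nl : ~~ cut_large (D :\ a).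
  apply/negP => h; have /minsetP[_ hm] := minD.
  have := hm _ h (subsetDl _ _) => /setP/(_ a); by rewrite !inE eqxx aD.
move: nl; rewrite negb_forall => /existsP[X]; rewrite negb_imply -ltnNge => /andP[/andP[uX vX] lt].
have := @outs_setD D [set a] X; rewrite sub1set aD => /(_ isT) h.
have h1 : outs [:: a] X = ((a.1 \in X) && (a.2 \notin X) : nat) by rewrite /outs /= addn0.
rewrite enum_set1 h1 in h; have := min_large uX vX; rewrite h.
case: andP h => [[a1 a2] h le|_ _ le]; last by exfalso; move: lt le; clear; lia.
exists X; split=> //; rewrite /tight_out uX vX h !andTb.
by move: lt le; clear; lia.
Qed.

Lemma tight_outU X Y : tight_out X -> tight_out Y -> tight_out (X :|: Y) && tight_out (X :&: Y).
Proof.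
case/and3P=> uX vX /eqP oX /and3P[uY vY /eqP oY].
have uU : u \in X :|: Y by rewrite inE uX.
have vU : v \notin X :|: Y by rewrite inE negb_or vX.
have uI : u \in X :&: Y by rewrite inE uX.
have vI : v \notin X :&: Y by rewrite inE negb_and vX.
rewrite /tight_out uU vU uI vI !andTb; have := min_large uU vU; have := min_large uI vI.
have := outs_submod (enum D) X Y; rewrite oX oY => h1 h2 h3.
by apply/andP; split; apply/eqP; move: h1 h2 h3; clear; lia.
Qed.

Lemma no_arc_into_u a : a \in D -> a.2 != u.
Proof. by case/arc_tight => X [/and3P[uX _ _] _ aX]; apply: contraNneq aX => ->. Qed.

Lemma no_loop x : (x, x) \notin D.
Proof. by apply/negP => /arc_tight[X [_ /= ->]]. Qed.

(** Each arc into [x] leaves a tight set missing [x], so all of them start in a maximal such set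
    [X]. Adding [x] to [X] cannot lower the out-cut below [k], so at least as many arcs leave
    [x]. *)
Lemma arcs_in x : x != v -> btw (enum D) [set~ x] [set x] <= btw (enum D) [set x] [set~ x].
Proof.
move=> xv; have [->//|] := posnP (btw (enum D) [set~ x] [set x]).
rewrite -has_count => /hasP[a]; rewrite mem_enum => aD /andP[_]; rewrite inE => /eqP a2.
have [X0 [tX0 _]] := arc_tight aD; rewrite a2 => xX0.
have pX0 : tight_out X0 && (x \notin X0) by rewrite tX0 xX0.
have [X /maxsetP[/andP[tX xX] maxX] _] :=
  @maxset_exists _ (fun X => tight_out X && (x \notin X)) X0 pX0.
have [uX vX /eqP oX] := and3P tX.
have -> : btw (enum D) [set~ x] [set x] = btw (enum D) X [set x].
  apply/eq_in_count => b; rewrite mem_enum !inE => bD; case: (eqVneq b.2 x) => [b2|_] /=; rewrite ?andbF // !andbT.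
  have [Y [tY b1 b2Y]] := arc_tight bD.
  have xY : x \notin Y by rewrite -b2.
  have -> : b.1 \in X.
    rewrite -(maxX (X :|: Y)) ?subsetUl ?inE ?b1 ?orbT //.
    by have /andP[-> _] := tight_outU tX tY; rewrite ?inE ?negb_or xX.
  by apply: contraNneq xY => <-.
have := outs_add1 (enum D) xX.
have : k <= out (x |: X) by apply: min_large; rewrite !inE ?uX ?orbT // negb_or eq_sym xv.
have : btw (enum D) [set x] (~: (x |: X)) <= btw (enum D) [set x] [set~ x].
  by apply: btwS => //; rewrite setCS subsetUl.
rewrite oX; clear; lia.
Qed.

(** Dual to [arcs_in]: all arcs from [x] leave a minimal tight set containing [x], from which [x] is
    then removed. *)
Lemma arcs_out x : x != u -> btw (enum D) [set x] [set~ x] <= btw (enum D) [set~ x] [set x].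
Proof.
move=> xu; have [->//|] := posnP (btw (enum D) [set x] [set~ x]).
rewrite -has_count => /hasP[a]; rewrite mem_enum => aD /andP[]; rewrite inE => /eqP a1 _.
have [X0 [tX0]] := arc_tight aD; rewrite a1 => xX0 _.
have pX0 : tight_out X0 && (x \in X0) by rewrite tX0 xX0.
have [X /minsetP[/andP[tX xX] minX] _] :=
  @minset_exists _ (fun X => tight_out X && (x \in X)) X0 pX0.
have [uX vX /eqP oX] := and3P tX.
have eX : x |: X :\ x = X by rewrite setD1K.
have -> : btw (enum D) [set x] [set~ x] = btw (enum D) [set x] (~: (x |: X :\ x)).
  rewrite eX; apply/eq_in_count => b; rewrite mem_enum !inE => bD; case: eqP => [b1|] //=.
  have [Y [tY b1Y b2]] := arc_tight bD.
  have xY : x \in Y by rewrite -b1.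
  have -> : b.2 \notin X.
    rewrite -(minX (X :&: Y)) ?subsetIl ?inE ?negb_and ?b2 ?orbT //.
    by have /andP[_ ->] := tight_outU tX tY; rewrite ?inE xX.
  by apply: contraNneq b2 => ->.
have xD : x \notin X :\ x by rewrite !inE eqxx.
have := outs_add1 (enum D) xD; rewrite eX.
have : k <= out (X :\ x) by apply: min_large; rewrite !inE ?uX ?(negbTE vX) ?andbF // eq_sym xu.
have : btw (enum D) (X :\ x) [set x] <= btw (enum D) [set~ x] [set x].
  by apply: btwS => //; apply/subsetP => y; rewrite !inE => /andP[].
rewrite oX; clear; lia.
Qed.

Lemma outdeg_btw x : count (fun a => a.1 == x) (enum D) = btw (enum D) [set x] [set~ x].
Proof.
apply: eq_in_count => -[y z]; rewrite mem_enum !inE /=; case: eqP => //= -> h.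
by apply/esym; apply: contraTneq h => ->; apply: no_loop.
Qed.

Lemma indeg_btw x : count (fun a => a.2 == x) (enum D) = btw (enum D) [set~ x] [set x].
Proof.
apply: eq_in_count => -[y z]; rewrite mem_enum !inE /=; case: eqP => //= [->|] h; rewrite ?andbF ?andbT //.
by apply/esym; apply: contraTneq h => ->; apply: no_loop.
Qed.

(** The vertices other than [u] and [v] are balanced and no arc enters [u], so the net flow out of
    [X] is the out-degree of [u]. *)
Lemma out_net X : u \in X -> v \notin X -> out (~: X) + k <= out X.
Proof.
move=> uX vX; rewrite -(@outs_net (enum D) u X uX) ?leq_add2l.
- apply: leq_trans (min_large (set11 u) _) _; first by rewrite inE eq_sym (in_notin_neq uX vX).
  by apply: sub_count => a; rewrite !inE => /andP[].
- by apply/eqP; rewrite eqn0Ngt -has_count; apply/hasPn => a; rewrite mem_enum => /no_arc_into_u.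
- move=> x xX xu; rewrite indeg_btw outdeg_btw; apply/eqP.
  by rewrite eqn_leq arcs_in ?arcs_out // (in_notin_neq xX vX).
Qed.

End Minimal.

(** In a minimal arc set the net flow out of every cut is at least [k + 1]; any path carries net
    flow one, so [k] remains after its removal and the induction continues. *)
Lemma menger k u v D : u != v ->
  (forall X, u \in X -> v \notin X -> k <= outs (enum D) X) ->
  exists2 P : {set #|T|.-bseq T}, arc_disjoint_paths (arc_rel D) u v P & #|P| = k.
Proof.
move=> nuv; elim: k D => [|k IH] D0 hD0.
  exists set0; rewrite ?cards0 //; apply/andP; split; apply/forall_inP => p; by rewrite inE.
have pD0 : cut_large k.+1 u v D0.
  by apply/forallP => X; apply/implyP => /andP[]; apply: hD0.
have [D minD sD] := minset_exists pD0.
have conn : connect (arc_rel D) u v.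
  apply: contraT => nc; pose X := [set y | connect (arc_rel D) u y].
  have : k.+1 <= outs (enum D) X by apply: (min_large minD); rewrite !inE ?connect0.
  rewrite /outs => h; have : has (fun a => (a.1 \in X) && (a.2 \notin X)) (enum D).
    by rewrite has_count; move: h; clear; lia.
  case/hasP => -[y z]; rewrite mem_enum !inE /= => yzD /andP[cy /negP[]].
  by apply: connect_trans cy (connect1 _).
have [p0 path0 last0] := connectP conn.
case/shortenP: path0 last0 => p path_p uniq_p _ last_p.
have sz : size p <= #|T|.
  by have := uniq_leq_size uniq_p (fun x _ => mem_enum T x); rewrite -cardE /=; clear; lia.
pose pb := Bseq sz; pose A := [set a in path_arcs u p].
have sA : A \subset D by apply/subsetP=> -[x y]; rewrite inE => h; exact: (mem_path_arcs path_p h).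
have cA X : outs (enum A) X = outs (path_arcs u p) X.
  apply: outs_perm; apply: uniq_perm; rewrite ?enum_uniq ?uniq_path_arcs //.
  by move=> a; rewrite mem_enum inE.
have [P dP cP] : exists2 P : {set #|T|.-bseq T}, arc_disjoint_paths (arc_rel (D :\: A)) u v P & #|P| = k.
  apply: IH => X uX vX; have := out_net minD uX vX.
  rewrite !(outs_setD _ sA) !cA; have := path_outs X u p; rewrite -last_p uX (negbTE vX).
  clear; lia.
have /andP[/forall_inP pathP /forall_inP disjP] := dP.
have pbA : {in path_arcs u p, forall a, a \in A} by move=> a; rewrite inE.
have PA q : q \in P -> {in path_arcs u q, forall a, a \in D :\: A}.
  by move=> /pathP/and3P[pq _ _] [x y] h; exact: (mem_path_arcs pq h).
have dpq q : q \in P -> [disjoint path_arcs u p & path_arcs u q].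
  move=> qP; rewrite disjoint_has; apply/hasPn => a /pbA aA; apply/negP => /(PA q qP).
  by rewrite inE aA.
have pbP : pb \notin P.
  apply/negP => /dpq; rewrite /pb /=.
  case: (p) last_p => [/= e|y p' _]; first by rewrite e eqxx in nuv.
  by rewrite disjoint_has /path_arcs /= mem_head.
exists (pb |: P); last by rewrite cardsU1 pbP cP.
have subr : subrel (arc_rel (D :\: A)) (arc_rel D0).
  by move=> x y /setDP[/(subsetP sD)].
apply/andP; split.
  apply/forall_inP => q /setU1P[->|/pathP/and3P[pq lq uq]].
    apply/and3P; split=> //; last by rewrite last_p.
    by apply: sub_path path_p => x y; apply: (subsetP sD).
  by rewrite /is_path lq uq (sub_path subr pq).
apply/forall_inP => q hq; apply/forall_inP => q' hq'; apply/implyP => nqq'.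
case/setU1P: hq => [eq|qP]; case/setU1P: hq' => [eq'|qP'].
- by rewrite eq eq' eqxx in nqq'.
- by rewrite eq; apply: dpq.
- by rewrite eq' disjoint_sym; apply: dpq.
- by have /forall_inP/(_ q' qP')/implyP := disjP q qP; apply.
Qed.

Lemma lambda_digraph_ge k u v D : u != v ->
  (forall X, u \in X -> v \notin X -> k <= outs (enum D) X) ->
  k <= lambda_digraph (arc_rel D) u v.
Proof.
move=> nuv h; have [P dP <-] := menger nuv h.
exact: (leq_bigmax_cond (F := fun P : {set #|T|.-bseq T} => #|P|)).
Qed.

End Menger.

(** * The average connectivities *)

Section SimpleGraph.
Variables (T : finType) (e : rel T).
Hypotheses (e_sym : symmetric e) (e_irr : irreflexive e).
Implicit Types (X : {set T}) (u v x y : T) (a b : T * T) (O : seq (T * T)).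

Local Notation ends := (@ends T).

Definition edges : seq (T * T) :=
  [seq a <- enum {: T * T} | e a.1 a.2 && (enum_rank a.1 < enum_rank a.2)].

Lemma ends_eq x y a : ends a = [set x; y] -> a = (x, y) \/ a = (y, x).
Proof.
case: a => a1 a2; rewrite /ends /= => h.
have := set21 x y; have := set22 x y; rewrite -h !inE.
have := set21 a1 a2; have := set22 a1 a2; rewrite h !inE.
by do 4![case/orP => /eqP ?]; subst; auto.
Qed.

Lemma e_neq x y : e x y -> x != y.
Proof. by apply: contraTneq => ->; rewrite e_irr. Qed.

Lemma mem_edges a : (a \in edges) = e a.1 a.2 && (enum_rank a.1 < enum_rank a.2).
Proof. by rewrite mem_filter mem_enum andbT. Qed.

Lemma ends_edges x y : ([set x; y] \in map ends edges) = e x y.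
Proof.
apply/mapP/idP => [[a]|exy].
  rewrite mem_edges => /andP[ea _] /esym/ends_eq[] ea'; move: ea; rewrite ea' //=.
  by rewrite e_sym.
have [lt|lt|/val_inj/enum_rank_inj eq] := ltngtP (enum_rank x) (enum_rank y).
- by exists (x, y); rewrite // mem_edges exy.
- by exists (y, x); [rewrite mem_edges /= e_sym exy | exact: setUC].
- by move: (e_neq exy); rewrite eq eqxx.
Qed.

Lemma uniq_ends_edges : uniq (map ends edges).
Proof.
rewrite map_inj_in_uniq => [|a [b1 b2]]; first exact: filter_uniq (enum_uniq _).
rewrite !mem_edges /= => /andP[_ la] /andP[_ lb] /ends_eq[-> //|eqa].
by move: la lb; rewrite eqa /=; clear; lia.
Qed.

Lemma orientation_set O : map ends O = map ends edges -> is_orientation e [set a in O].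
Proof.
move=> mO; have uO : uniq (map ends O) by rewrite mO uniq_ends_edges.
apply/forallP => x; apply/forallP => y; rewrite /arc_rel /= !inE.
have [exy|nexy] := ifPn; last first.
  by apply: contra nexy => h; rewrite -ends_edges -mO; apply: (map_f ends h).
have /mapP[a aO ea] : [set x; y] \in map ends O by rewrite mO ends_edges.
have nxy := e_neq exy.
have nboth : ~~ (((x, y) \in O) && ((y, x) \in O)).
  apply/negP => /andP[h1 h2]; have pO := perm_to_rem h1.
  have : uniq (map ends ((x, y) :: rem (x, y) O)).
    by rewrite -(perm_uniq (perm_map ends pO)).
  have h3 : (y, x) \in rem (x, y) O.
    move: h2; rewrite (perm_mem pO) inE => /orP[/eqP[ey]|//].
    by rewrite ey eqxx in nxy.
  rewrite /= => /andP[/negP[]]; have -> : ends (x, y) = ends (y, x) by exact: setUC.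
  exact: map_f.
by case: (ends_eq (esym ea)) => eqa; move: nboth; rewrite -eqa aO ?andbT /= => /negbTE ->.
Qed.

Lemma outs_set O X : uniq O -> outs (enum [set a in O]) X = outs O X.
Proof.
move=> uO; apply: outs_perm; apply: uniq_perm; rewrite ?enum_uniq // => a.
by rewrite mem_enum inE.
Qed.

Lemma path_crosses u v X p : u \in X -> v \notin X -> last u p = v ->
  exists2 a, a \in path_arcs u p & crosses X a.
Proof.
move=> uX vX lp; have := path_outs X u p; rewrite lp uX (negbTE vX) addn0 => h.
have : 0 < outs (path_arcs u p) X by rewrite h addn1.
rewrite /outs -has_count => /hasP[a ap /andP[a1 a2]].
by exists a => //; rewrite /crosses a1 (negbTE a2).
Qed.

Lemma crossing_edge X a : e a.1 a.2 -> crosses X a ->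
  ends a \in map ends [seq b <- edges | crosses X b].
Proof.
move=> ea ca; have : ends a \in map ends edges by rewrite ends_edges.
case/mapP => b bE eab; rewrite eab; apply: map_f; rewrite mem_filter bE andbT.
by rewrite -(crosses_ends X eab).
Qed.

(** The easy half of Menger's theorem: sending each path to its first edge across [X] is injective
    by disjointness. *)
Lemma lambda_graph_le_cut u v X : u \in X -> v \notin X -> lambda_graph e u v <= cut edges X.
Proof.
move=> uX vX; apply/bigmax_leqP => P /andP[/forall_inP pathP /forall_inP disjP].
pose c p := [seq ends a | a <- path_arcs u p & crosses X a].
pose f (p : #|T|.-bseq T) := head set0 (c p).
have cf p : p \in P -> f p \in c p.
  move=> /pathP/and3P[_ /eqP lp _]; have [a ap ca] := path_crosses uX vX lp.
  rewrite /f; have : ends a \in c p by apply: map_f; rewrite mem_filter ca.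
  by case: (c p) => //= b l _; rewrite mem_head.
have fe p : p \in P -> f p \in path_edges u p.
  move=> /cf/mapP[a]; rewrite mem_filter => /andP[_ ap] ->; exact: (map_f ends).
have fE p : p \in P -> f p \in map ends [seq b <- edges | crosses X b].
  move=> pP; have /and3P[pp _ _] := pathP p pP.
  have /mapP[a] := cf p pP; rewrite mem_filter => /andP[ca ap] ->.
  exact: crossing_edge (mem_path_arcs pp ap) ca.
have fI : {in P &, injective f}.
  move=> p q pP qP eqf; apply/eqP; apply: contraT => npq.
  have /forall_inP/(_ q qP)/implyP/(_ npq) := disjP p pP.
  by move/disjointFr/(_ (fe p pP)); rewrite eqf fe.
rewrite -(card_in_imset fI) /cut -size_filter -(size_map ends).
apply: leq_trans (card_size _); apply/subset_leq_card/subsetP => _ /imsetP[p pP ->].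
exact: fE.
Qed.

Lemma cut_ge2 u v X : edge_connected 2 e -> u \in X -> v \notin X -> 2 <= cut edges X.
Proof.
move=> [_ conn] uX vX; rewrite leqNgt; apply/negP => lt2.
pose F := [set S in map ends [seq b <- edges | crosses X b]].
have sF : F \subset edge_set e.
  apply/subsetP => S; rewrite inE => /mapP[b]; rewrite mem_filter mem_edges => /and3P[_ eb _] ->.
  by apply/imsetP; exists b.
have cF : #|F| < 2.
  apply: leq_ltn_trans lt2; rewrite /cut -size_filter -(size_map ends) cardsE; exact: card_size.
have [p pp /esym lp] := connectP (conn F sF cF u v).
have [a ap ca] := path_crosses uX vX lp.
have := mem_path_arcs pp ap; rewrite /= => /andP[ea].
by rewrite inE -/(ends a) (crossing_edge ea ca).
Qed.

Lemma lambda_graph_gt0 u v : edge_connected 2 e -> u != v -> 0 < lambda_graph e u v.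
Proof.
move=> [_ conn] nuv.
have [p0 path0 last0] := connectP (conn set0 (sub0set _) ltac:(by rewrite cards0) u v).
case/shortenP: path0 last0 => p path_p uniq_p _ last_p.
have sz : size p <= #|T|.
  by have := uniq_leq_size uniq_p (fun x _ => mem_enum T x); rewrite -cardE /=; clear; lia.
apply: leq_trans (leq_bigmax_cond (F := fun P : {set #|T|.-bseq T} => #|P|) [set Bseq sz] _).
  by rewrite cards1.
apply/andP; split.
  apply/forall_inP => q /set1P ->; apply/and3P; split=> //; last by rewrite last_p.
  by apply: sub_path path_p => x y /andP[].
apply/forall_inP => q /set1P ->; apply/forall_inP => q' /set1P ->.
by rewrite eqxx.
Qed.

Lemma balanced_orientation : edge_connected 2 e ->
  exists2 D, is_orientation e D & forall u v, u != v ->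
    lambda_graph e u v <= 3 * lambda_digraph (arc_rel D) u v /\
    lambda_graph e u v <= 3 * lambda_digraph (arc_rel D) v u.
Proof.
move=> conn; have [O [mO hO]] := well_balanced_orientation edges.
have uO : uniq O by apply: (map_uniq (f := ends)); rewrite mO uniq_ends_edges.
exists [set a in O]; first exact: orientation_set.
have lam u v : u != v -> (mincut edges u v)./2 <= lambda_digraph (arc_rel [set a in O]) u v.
  move=> nuv; apply: lambda_digraph_ge => // X uX vX; rewrite outs_set //.
  by have := req_le_Req edges uX vX; have := hO X; rewrite /req; clear; lia.
move=> u v nuv; have nvu : v != u by rewrite eq_sym.
have := lam u v nuv; have := lam v u nvu; rewrite -(mincutC _ nuv).
have [X /andP[uX vX] eX] := mincutP edges nuv.
have := cut_ge2 conn uX vX; have := lambda_graph_le_cut uX vX; rewrite -eX.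
clear => h1 h2 h3 h4; split; lia.
Qed.

End SimpleGraph.

Lemma sum_neq_rank (T : finType) (f : T -> T -> nat) :
  \sum_(u : T) \sum_(v | u != v) f u v =
  \sum_(u : T) \sum_(v : T | enum_rank u < enum_rank v) (f u v + f v u).
Proof.
have -> : \sum_(u : T) \sum_(v : T | enum_rank u < enum_rank v) (f u v + f v u) =
    \sum_(u : T) \sum_(v : T | enum_rank u < enum_rank v) f u v +
    \sum_(u : T) \sum_(v : T | enum_rank u < enum_rank v) f v u.
  by rewrite -big_split; apply: eq_bigr => u _; rewrite big_split.
rewrite [X in _ + X](exchange_big_dep xpredT) //= -big_split; apply: eq_bigr => u _ /=.
rewrite (bigID (fun v => enum_rank u < enum_rank v)) /=; congr (_ + _); apply: eq_bigl => v.
  by case: (eqVneq u v) => [->|//]; rewrite ltnn.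
rewrite -leqNgt; case: (eqVneq u v) => [->|nuv]; first by rewrite ltnn.
by rewrite leq_eqVlt val_eqE (inj_eq enum_rank_inj) eq_sym (negbTE nuv).
Qed.

Import Order.TTheory GRing.Theory Num.Theory.
Local Open Scope ring_scope.

Theorem theorem2p6 (T : finType) (e : rel T)
    (e_sym : symmetric e) (e_irr : irreflexive e)
    (e_2conn : edge_connected 2 e) :
  1 / 3 <= max_avg_lambda e / avg_lambda_graph e.
Proof.
have [D oD lamD] := balanced_orientation e_sym e_irr e_2conn.
have n_gt1 : (1 < #|T|)%N by case: e_2conn.
pose n2 := (#|T| * #|T|.-1)%N.
have n2_gt0 : (0 < n2)%N by rewrite /n2 muln_gt0; move: n_gt1; clear; lia.
have binE : (n2 = 'C(#|T|, 2) * 2)%N by rewrite bin2 -divn2 divnK // dvdn2 oddM; case: #|T| => //= n; rewrite andNb.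
have bin_gt0 : (0 < 'C(#|T|, 2))%N by rewrite bin_gt0.
pose Sf := (\sum_(u : T) \sum_(v | u != v) lambda_digraph (arc_rel D) u v)%N.
pose Sg := (\sum_(u : T) \sum_(v : T | enum_rank u < enum_rank v) lambda_graph e u v)%N.
have avgD : avg_lambda_digraph (arc_rel D) = Sf%:R / n2%:R.
  rewrite /avg_lambda_digraph mulrC natr_sum; congr (_ / _).
  by apply: eq_bigr => u _; rewrite natr_sum.
have avgG : avg_lambda_graph e = Sg%:R / ('C(#|T|, 2))%:R.
  rewrite /avg_lambda_graph mulrC natr_sum; congr (_ / _).
  by apply: eq_bigr => u _; rewrite natr_sum.
have le_S : (Sg * 2 <= 3 * Sf)%N.
  rewrite /Sf sum_neq_rank big_distrl big_distrr; apply: leq_sum => u _ /=.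
  rewrite big_distrl big_distrr; apply: leq_sum => v luv /=.
  have nuv : u != v by apply: contraTneq luv => ->; rewrite ltnn.
  by have [] := lamD u v nuv; clear; lia.
(* The denominator must be nonzero, as a quotient by zero would be zero here. *)
have Sg_gt0 : (0 < Sg)%N.
  have /card_gt1P[u [v [_ _ nuv]]] : (1 < #|predT : pred T|)%N by rewrite cardT -cardE.
  wlog luv : u v nuv / (enum_rank u < enum_rank v)%N => [hw|].
    have [lt|lt|/val_inj/enum_rank_inj eq] := ltngtP (enum_rank u) (enum_rank v).
    - exact: hw lt.
    - by apply: hw lt; rewrite eq_sym.
    - by rewrite eq eqxx in nuv.
  rewrite /Sg (bigD1 u) //= (bigD1 v) //= -addnA.
  exact: leq_trans (lambda_graph_gt0 e_2conn nuv) (leq_addr _ _).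
have max_ge : avg_lambda_digraph (arc_rel D) <= max_avg_lambda e.
  exact: (le_bigmax_cond _ (fun D => avg_lambda_digraph (arc_rel D))).
have G_gt0 : 0 < avg_lambda_graph e by rewrite avgG divr_gt0 ?ltr0n.
rewrite ler_pdivlMr //; apply: le_trans max_ge; rewrite avgD avgG binE natrM.
have c_neq0 : ('C(#|T|, 2))%:R != 0 :> rat by rewrite pnatr_eq0 -lt0n.
rewrite -subr_ge0.
have -> : Sf%:R / (('C(#|T|, 2))%:R * 2) - 1 / 3 * (Sg%:R / ('C(#|T|, 2))%:R) =
    (3 * Sf%:R - Sg%:R * 2) / (6 * ('C(#|T|, 2))%:R) :> rat by field.
by rewrite divr_ge0 ?mulr_ge0 ?ler0n // subr_ge0 -!natrM ler_nat.
Qed.
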